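(* Let $(\Sigma,\mathcal{B},\mu)$ be a measure space, $H=L^2(\Sigma)$, $V$ a real locally convex topological vector space and $j:V\to L^2(\Sigma)$ a linear, weak-to-weak continuous operator. Assume that $\varphi:V\to\mathbb{R}\cup\{+\infty\}$ is convex, proper, lower semicontinuous and $j$-elliptic, and that $j(D(\varphi))$ is dense in $L^2(\Sigma)$. Suppose that $C\subseteq L^2(\Sigma)$ is a closed convex set satisfying $u\wedge v\in C$ and $u\vee v\in C$ for every $u,v\in C$, and that the semigroup $S$ on $L^2(\Sigma)$ generated by $(\varphi,j)$ leaves $C$ invariant. Then the following assertions are equivalent: (1) The semigroup $S$ is order preserving on $C$. (2) For every $u_1,u_2\in C$ one has $\varphi^H(u_1\wedge u_2)+\varphi^H(u_1\vee u_2)\le\varphi^H(u_1)+\varphi^H(u_2)$. (3) For every $\hat u_1,\hat u_2\in D(\varphi)$ with $u_1:=j(\hat u_1)\in C$ and $u_2:=j(\hat u_2)\in C$, there are $\hat v_1,\hat v_2\in D(\varphi)$ such that $u_1\wedge u_2=j(\hat v_1)$, $u_1\vee u_2=j(\hat v_2)$ and $\varphi(\hat v_1)+\varphi(\hat v_2)\le\varphi(\hat u_1)+\varphi(\hat u_2)$.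
   Context: The effective domain of $\varphi$ is $D(\varphi)=\{\varphi<+\infty\}$; $\varphi$ is proper if $D(\varphi)\neq\emptyset$, lower semicontinuous if all sublevels $\{\varphi\le c\}$, $c\in\mathbb{R}$, are closed, and coercive if all sublevels are relatively weakly compact. The functional $\varphi$ is $j$-elliptic if there exists $\omega\ge 0$ such that $\hat u\mapsto\varphi(\hat u)+\frac{\omega}{2}\|j(\hat u)\|_H^2$ is convex and coercive. The $j$-subgradient of $\varphi$ is $$\partial_j\varphi=\Big\{(u,f)\in H\times H \;:\; \exists\,\hat u\in D(\varphi)\text{ with } j(\hat u)=u \text{ and, for every }\hat v\in V,\ \liminf_{t\searrow 0}\frac{\varphi(\hat u+t\hat v)-\varphi(\hat u)}{t}\ge\langle f,j(\hat v)\rangle_H\Big\}.$$ $\partial\psi$ denotes the classical subgradient of a functional $\psi$ on $H$ (the case $V=H$, $j=I$). $\varphi^H:H\to\mathbb{R}\cup\{+\infty\}$ denotes a convex, proper, lower semicontinuous functional with $\partial_j\varphi\subseteq\partial\varphi^H$; it exists, is unique up to an additive constant, and modulo that constant $\varphi^H(u)=\inf\{\varphi(\hat u): j(\hat u)=u\}$. The semigroup generated by $(\varphi,j)$: for every $u_0\in\overline{j(D(\varphi))}$ (here all of $L^2(\Sigma)$) the problem $\dot u+\partial_j\varphi(u)\ni 0$ a.e. on $(0,\infty)$, $u(0)=u_0$, has a unique solution $u\in C(\mathbb{R}_+;H)\cap W^{1,\infty}_{loc}((0,\infty);H)$, and $S(t)u_0:=u(t)$. $S$ leaves $C$ invariant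 if $S(t)C\subseteq C$ for every $t\ge 0$. $S$ is order preserving on $C$ if for every $u,v\in C$ with $u\le v$ one has $S(t)u\le S(t)v$ for every $t\ge 0$. $L^2(\Sigma)$ (real-valued) carries the natural almost everywhere ordering with lattice operations $\wedge$ and $\vee$. *)

(* Defs.v *)
From HB Require Import structures.
From mathcomp Require Import all_boot all_order all_algebra.
From mathcomp Require Import all_classical all_reals all_analysis.
From mathcomp Require Import measurable_realfun ess_sup_inf hoelder.
Set Implicit Arguments.
Unset Strict Implicit.
Unset Printing Implicit Defensive.
Import Order.TTheory GRing.Theory Num.Theory.
Import numFieldNormedType.Exports.
Local Open Scope classical_set_scope.
Local Open Scope ring_scope.
Local Open Scope quotient_scope.

(* The library's [LspaceType mu p1], classes of measurable functions modulo
   a.e. equality, comes without algebraic structure; it is made a normed space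
   and a lattice here, all operations being the pointwise ones on
   representatives. *)
Section Lspace_normed.
Context {d : measure_display} {T : measurableType d} {R : realType}.
Variable mu : {measure set T -> \bar R}.
Variables (p : \bar R) (p1 : (1 <= p)%E).

Lemma eq_ae_Lnorm (f g : T -> R) :
  measurable_fun setT f -> measurable_fun setT g ->
  f = g %[ae mu] -> 'N[mu]_p[EFin \o f]%E = 'N[mu]_p[EFin \o g]%E.
Proof.
move=> mf mg fg; rewrite unlock /Lnorm; case: p p1 => // [r _|_].
  have mpow (h : T -> R) : measurable_fun setT h ->
      measurable_fun setT (fun x => (`|(EFin \o h) x| `^ r)%E : \bar R).
    move=> mh; have mah : measurable_fun setT (abse \o (EFin \o h) : T -> \bar R).
      by apply: measurableT_comp => //; exact/measurable_EFinP.
    exact: (measurableT_comp (measurable_poweR r) mah).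
  congr (_ `^ _)%E; apply: ae_eq_integral => //; [exact: mpow|exact: mpow|].
  by apply: filterS fg => x fgx Dx /=; rewrite fgx.
by case: ifP => // _; apply: eq_ess_sup; apply: filterS fg => x /(_ I) /= ->.
Qed.

Local Notation Lf := (LfunType mu p1).
Local Notation L := (LspaceType mu p1).

Definition mfun_of_Lfun (f : Lf) : {mfun T >-> measurableTypeR R} :=
  HB.pack_for {mfun T >-> measurableTypeR R} (f : T -> measurableTypeR R)
    (@isMeasurableFun.Build _ _ T (measurableTypeR R) f (measurable_funPT f)).

Definition Lclass_mfun (f : Lf) : {mfun_ mu, T >-> measurableTypeR R} :=
  \pi_(aeEqMfun _ mu) (mfun_of_Lfun f).

Lemma Lclass_mfunE (f : Lf) : (Lclass_mfun f : T -> R) = f %[ae mu].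
Proof.
have : \pi_(aeEqMfun _ mu) (repr (Lclass_mfun f)) = Lclass_mfun f.
  exact: reprK.
by move/eqmodP/asboolP.
Qed.

Lemma Lclass_finite (f : Lf) : finite_norm mu p (Lclass_mfun f).
Proof.
rewrite /finite_norm (eq_ae_Lnorm _ _ (Lclass_mfunE f)).
- exact: Lfunction_finite.
- exact: (@measurable_funPT _ _ _ _ (repr (Lclass_mfun f))).
- exact: measurable_funPT.
Qed.

HB.instance Definition _ (f : Lf) :=
  @isFinLebesgue.Build d T R mu p p1 (Lclass_mfun f) (Lclass_finite f).

Definition Lclass (f : Lf) : L := [the L of Lclass_mfun f].

Lemma Lrepr_in (u : L) : (u : T -> R) \in Lfun mu p.
Proof.
apply/andP; split; rewrite inE//=; last exact: Lebesgue_finite.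
exact: (@measurable_funPT _ _ _ _ (repr (u : {mfun_ mu, T >-> _}))).
Qed.

Definition Lrepr (u : L) : Lf := Lfun_Sub p1 (Lrepr_in u).

Lemma Lspace_val_inj (u v : L) :
  (u : {mfun_ mu, T >-> measurableTypeR R}) = v -> u = v.
Proof.
case: u v => [u [[cu]]] [v [[cv]]] /= uv.
move: cu cv; rewrite uv => cu cv.
by rewrite (Prop_irrelevance cu cv).
Qed.

Lemma LspaceP (u v : L) : u = v <-> (u : T -> R) = v %[ae mu].
Proof.
split=> [->|uv]; first by apply: nearW.
apply: Lspace_val_inj; rewrite -[LHS]reprK -[RHS]reprK.
exact/eqmodP/asboolP.
Qed.

Lemma LclassE (f : Lf) : (Lclass f : T -> R) = f %[ae mu].
Proof. exact: Lclass_mfunE. Qed.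

Lemma Lclass_eq (f g : Lf) :
  Lclass f = Lclass g <-> (f : T -> R) = g %[ae mu].
Proof.
rewrite LspaceP; have cf := LclassE f; have cg := LclassE g.
split=> [fg|fg].
  by apply: ae_eq_trans cg; apply: ae_eq_trans fg; exact: ae_eq_sym.
by apply: ae_eq_trans (ae_eq_sym cg); exact: ae_eq_trans fg.
Qed.

Lemma LreprK (u : L) : Lclass (Lrepr u) = u.
Proof. by apply/LspaceP; exact: LclassE. Qed.

HB.instance Definition _ := gen_eqMixin L.
HB.instance Definition _ := gen_choiceMixin L.

Definition Lspace_add (u v : L) : L := Lclass (Lrepr u + Lrepr v).
Definition Lspace_opp (u : L) : L := Lclass (- Lrepr u).
Definition Lspace_scale (a : R) (u : L) : L := Lclass (a *: Lrepr u).

Let addC (f g : Lf) : Lspace_add (Lclass f) (Lclass g) = Lclass (f + g).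
Proof.
apply/Lclass_eq; apply: filterS2 (LclassE f) (LclassE g) => x fx gx _ /=.
by congr (_ + _); [exact: fx|exact: gx].
Qed.

Let oppC (f : Lf) : Lspace_opp (Lclass f) = Lclass (- f).
Proof.
by apply/Lclass_eq; apply: filterS (LclassE f) => x fx _ /=; congr (- _); exact: fx.
Qed.

Let scaleC a (f : Lf) : Lspace_scale a (Lclass f) = Lclass (a *: f).
Proof.
by apply/Lclass_eq; apply: filterS (LclassE f) => x fx _ /=; congr (_ *: _); exact: fx.
Qed.

Let LspaceW (P : L -> Prop) : (forall f, P (Lclass f)) -> forall u, P u.
Proof. by move=> Pf u; rewrite -(LreprK u). Qed.

Let addA : associative Lspace_add.
Proof.
elim/LspaceW => f; elim/LspaceW => g; elim/LspaceW => h.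
by rewrite !addC addrA.
Qed.

Let addCC : commutative Lspace_add.
Proof. by elim/LspaceW => f; elim/LspaceW => g; rewrite !addC addrC. Qed.

Let add0 : left_id (Lclass 0) Lspace_add.
Proof. by elim/LspaceW => f; rewrite addC add0r. Qed.

Let addN : left_inverse (Lclass 0) Lspace_opp Lspace_add.
Proof. by elim/LspaceW => f; rewrite oppC addC addNr. Qed.

HB.instance Definition _ := GRing.isZmodule.Build L addA addCC add0 addN.

Let scaleA a b v : Lspace_scale a (Lspace_scale b v) = Lspace_scale (a * b) v.
Proof. by elim/LspaceW: v => f; rewrite !scaleC scalerA. Qed.

Let scale1 : left_id 1 Lspace_scale.
Proof. by elim/LspaceW => f; rewrite scaleC scale1r. Qed.

Let scaleDr : right_distributive Lspace_scale +%R.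
Proof.
move=> a; elim/LspaceW => f; elim/LspaceW => g.
by rewrite /GRing.add /= !(addC, scaleC) scalerDr.
Qed.

Let scaleDl v : {morph Lspace_scale^~ v : a b / a + b}.
Proof.
move=> a b; elim/LspaceW: v => f.
by rewrite [in RHS]/GRing.add /= !(addC, scaleC) scalerDl.
Qed.

HB.instance Definition _ :=
  GRing.Zmodule_isLmodule.Build R L scaleA scale1 scaleDr scaleDl.

Lemma LspaceDE (u v : L) : (u + v : L) = u \+ v %[ae mu].
Proof. exact: LclassE. Qed.

Lemma LspaceNE (u : L) : (- u : L) = \- u %[ae mu].
Proof. exact: LclassE. Qed.

Lemma LspaceZE a (u : L) : (a *: u : L) = a \*: u %[ae mu].
Proof. exact: LclassE. Qed.

Definition Lspace_norm (u : L) : R := fine 'N[mu]_p[EFin \o u]%E.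

Let normC (f : Lf) : Lspace_norm (Lclass f) = fine 'N[mu]_p[EFin \o f]%E.
Proof.
congr fine; apply: eq_ae_Lnorm; last exact: LclassE.
- exact: (@measurable_funPT _ _ _ _ (repr (Lclass_mfun f))).
- exact: measurable_funPT.
Qed.

Let norm_leD (u v : L) : Lspace_norm (u + v) <= Lspace_norm u + Lspace_norm v.
Proof.
elim/LspaceW: u => f; elim/LspaceW: v => g.
by rewrite /GRing.add /= addC !normC ler_LnormD.
Qed.

Let normZ a (u : L) : Lspace_norm (a *: u) = `|a| * Lspace_norm u.
Proof.
elim/LspaceW: u => f.
rewrite /GRing.scale /= scaleC !normC -[LHS]/(fine 'N[mu]_p[EFin \o (a \*: f)]).
by rewrite LnormZ -finite_norm_fine.
Qed.

Let norm0_eq0 (u : L) : Lspace_norm u = 0 -> u = 0.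
Proof.
elim/LspaceW: u => f; rewrite normC => /fine_Lnormr_eq0 f0.
exact/Lclass_eq.
Qed.

HB.instance Definition _ :=
  Lmodule_isNormed.Build R L norm_leD normZ norm0_eq0.

End Lspace_normed.

Fact Lspace_display : Order.disp_t.
Proof. exact: Order.Disp tt tt. Qed.

Section Lspace_lattice.
Context {d : measure_display} {T : measurableType d} {R : realType}.
Variable mu : {measure set T -> \bar R}.
Variables (p : \bar R) (p1 : (1 <= p)%E).
Local Notation Lf := (LfunType mu p1).
Local Notation L := (LspaceType mu p1).

Let Lfun_abs (f : Lf) : Num.norm \o f \in Lfun mu p.
Proof.
apply/andP; split; rewrite inE/=; first exact: measurableT_comp.
rewrite /finite_norm -[X in 'N[mu]_p[X]%E]/(abse \o (EFin \o f)) Lnorm_abse.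
exact: Lfunction_finite.
Qed.

Let Labs (f : Lf) : Lf := Lfun_Sub p1 (Lfun_abs f).

Let Lfun_min (f g : Lf) : (fun x => Num.min (f x) (g x)) \in Lfun mu p.
Proof.
have -> : (fun x => Num.min (f x) (g x)) =
    (2^-1 *: (f + g - Labs (f - g)) : Lf).
  by apply/funext => x /=; rewrite minr_absE mulrC.
exact: LfunP.
Qed.

Let Lfun_max (f g : Lf) : (fun x => Num.max (f x) (g x)) \in Lfun mu p.
Proof.
have -> : (fun x => Num.max (f x) (g x)) =
    (2^-1 *: (f + g + Labs (f - g)) : Lf).
  by apply/funext => x /=; rewrite maxr_absE mulrC.
exact: LfunP.
Qed.

Definition Lspace_le (u v : L) : bool := `[< {ae mu, forall x, u x <= v x} >].
Definition Lspace_min (u v : L) : L :=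
  Lclass (Lfun_Sub p1 (Lfun_min (Lrepr u) (Lrepr v))).
Definition Lspace_max (u v : L) : L :=
  Lclass (Lfun_Sub p1 (Lfun_max (Lrepr u) (Lrepr v))).

Lemma Lspace_minE (u v : L) :
  Lspace_min u v = (fun x => Num.min (u x) (v x)) %[ae mu].
Proof. exact: LclassE. Qed.

Lemma Lspace_maxE (u v : L) :
  Lspace_max u v = (fun x => Num.max (u x) (v x)) %[ae mu].
Proof. exact: LclassE. Qed.

Let Lle_refl : reflexive Lspace_le.
Proof. by move=> u; apply/asboolP; apply: nearW => x. Qed.

Let Lle_anti : antisymmetric Lspace_le.
Proof.
move=> u v /andP[/asboolP uv /asboolP vu]; apply/LspaceP.
by apply: filterS2 uv vu => x uv vu _; apply/eqP; rewrite eq_le; apply/andP.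
Qed.

Let Lle_trans : transitive Lspace_le.
Proof.
move=> v u w /asboolP uv /asboolP vw; apply/asboolP.
by apply: filterS2 uv vw => x; exact: le_trans.
Qed.

Let LleI u v w : Lspace_le u (Lspace_min v w) = Lspace_le u v && Lspace_le u w.
Proof.
apply/asboolP/andP => [h|[/asboolP h1 /asboolP h2]].
  split; apply/asboolP; apply: filterS2 h (Lspace_minE v w) => x;
  by move=> /[swap] /(_ I) ->; rewrite le_min => /andP[].
have h : {ae mu, forall x, u x <= v x /\ u x <= w x}.
  by apply: filterS2 h1 h2 => x; split.
apply: filterS2 h (Lspace_minE v w) => x.
by move=> /[swap] /(_ I) -> [? ?]; rewrite le_min; apply/andP.
Qed.

Let LleU u v w : Lspace_le (Lspace_max u v) w = Lspace_le u w && Lspace_le v w.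
Proof.
apply/asboolP/andP => [h|[/asboolP h1 /asboolP h2]].
  split; apply/asboolP; apply: filterS2 h (Lspace_maxE u v) => x;
  by move=> /[swap] /(_ I) ->; rewrite ge_max => /andP[].
have h : {ae mu, forall x, u x <= w x /\ v x <= w x}.
  by apply: filterS2 h1 h2 => x; split.
apply: filterS2 h (Lspace_maxE u v) => x.
by move=> /[swap] /(_ I) -> [? ?]; rewrite ge_max; apply/andP.
Qed.

HB.instance Definition _ :=
  @Order.Le_isPOrder.Build Lspace_display L Lspace_le Lle_refl Lle_anti Lle_trans.
HB.instance Definition _ := @Order.POrder_MeetJoin_isLattice.Build
  Lspace_display L Lspace_min Lspace_max LleI LleU.

Lemma Lspace_leP (u v : L) :
  reflect {ae mu, forall x, u x <= v x} (u <= v :> L)%O.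
Proof. exact: asboolP. Qed.

Lemma Lspace_meetE (u v : L) :
  (u `&` v)%O = (fun x => Num.min (u x) (v x)) %[ae mu].
Proof. exact: Lspace_minE. Qed.

Lemma Lspace_joinE (u v : L) :
  (u `|` v)%O = (fun x => Num.max (u x) (v x)) %[ae mu].
Proof. exact: Lspace_maxE. Qed.

End Lspace_lattice.

Section L2_inner.
Context {d : measure_display} {T : measurableType d} {R : realType}.
Context {mu : {measure set T -> \bar R}}.

Definition L2_inner (u v : LspaceType2 mu) : R := \int[mu]_x (u x * v x).

Lemma L2_inner_norm (u : LspaceType2 mu) : L2_inner u u = `|u| ^+ 2.
Proof.
rewrite /L2_inner /Rintegral -[`|u|]/(Lspace_norm u) /Lspace_norm.
have fin : ('N[mu]_2%:E[EFin \o u] < +oo)%E by exact: Lebesgue_finite.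
have fin2 : 'N[mu]_2%:E[EFin \o u]%E \is a fin_num.
  by rewrite ge0_fin_numE// Lnorm_ge0.
rewrite -[RHS]/(fine (_%:E)) EFin_expe fineK//; congr fine.
have := @powR_Lnorm _ _ _ mu (EFin \o u) 2%R.
rewrite pnatr_eq0 => /(_ isT).
rewrite -[X in (X `^ _)%E = _]fineK// poweR_EFin powR_mulrn ?fine_ge0 ?Lnorm_ge0//.
rewrite EFin_expe fineK// => ->.
apply: eq_integral => x _ /=.
by rewrite powR_mulrn// -normrX ger0_norm ?sqr_ge0// expr2.
Qed.

End L2_inner.

Section weak_topology.
Context {R : realType}.

(* [weak V] is [V] with the coarsest topology making all continuous linear
   forms continuous. *)
Definition tvs_dual (V : tvsType R) := {f : {linear V -> R^o} | continuous f}.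

HB.instance Definition _ (V : tvsType R) := gen_eqMixin (tvs_dual V).
HB.instance Definition _ (V : tvsType R) := gen_choiceMixin (tvs_dual V).

Definition tvs_eval (V : tvsType R) (x : V) : {ptws tvs_dual V -> R^o} :=
  fun f => sval f x.

Definition weak (V : tvsType R) : Type := initial_topology (@tvs_eval V).

HB.instance Definition _ (V : tvsType R) := Topological.on (weak V).

Lemma weak_continuous (V : tvsType R) (f : tvs_dual V) :
  continuous (sval f : weak V -> R^o).
Proof.
move=> x.
have evx := @initial_continuous V {ptws tvs_dual V -> R^o} (@tvs_eval V) x.
have projx := @proj_continuous _ (fun _ : tvs_dual V => R^o) f (tvs_eval x).
exact: (continuous_comp evx projx).
Qed.

End weak_topology.

(* Functionals with values in R U {+oo} are maps to [\bar R] together with a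
   separate hypothesis that [-oo] is not taken. *)
Section functionals.
Context {R : realType}.
Local Open Scope ereal_scope.

Definition edomain {V : Type} (phi : V -> \bar R) : set V :=
  [set v | phi v < +oo].

Definition econvex {V : lmodType R} (phi : V -> \bar R) : Prop :=
  forall (x y : V) (t : R), (0 < t < 1)%R ->
    phi (t *: x + (1 - t) *: y)%R <= t%:E * phi x + (1 - t)%:E * phi y.

Definition coercive {V : tvsType R} (phi : V -> \bar R) : Prop :=
  forall c : R, precompact ([set v | phi v <= c%:E] : set (weak V)).

Definition j_elliptic {V : tvsType R} {H : normedModType R}
    (phi : V -> \bar R) (j : V -> H) : Prop :=
  exists2 omega : R, (0 <= omega)%R &
    let phi_omega v := phi v + (omega / 2 * `|j v| ^+ 2)%:E in
    econvex phi_omega /\ coercive phi_omega.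

Lemma lower_semicontinuous_sublevel {V : topologicalType} (phi : V -> \bar R) :
  lower_semicontinuous phi <-> forall c : R, closed [set v | phi v <= c%:E].
Proof.
rewrite lower_semicontinuousP; split=> h c.
  rewrite -openC (_ : ~` _ = [set v | phi v > c%:E])//.
  by apply/seteqP; split=> v /=; rewrite ltNge => /negP.
rewrite (_ : [set _ | _] = ~` [set v | phi v <= c%:E]) ?openC//.
by apply/seteqP; split=> v /=; rewrite ltNge => /negP.
Qed.

End functionals.

Section subgradient.
Context {d : measure_display} {T : measurableType d} {R : realType}.
Context {mu : {measure set T -> \bar R}}.
Local Notation H := (LspaceType2 mu).
Local Open Scope ereal_scope.

Definition j_subgradient {V : lmodType R} (phi : V -> \bar R) (j : V -> H)
  : set (H * H) := [set uf | exists u' : V,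
    [/\ edomain phi u', j u' = uf.1 & forall v' : V,
      limf_einf (fun t : R => (phi (u' + t *: v')%R - phi u') * (t^-1)%:E) 0^'+
        >= (L2_inner uf.2 (j v'))%:E]].

Definition subgradient (psi : H -> \bar R) : set (H * H) :=
  j_subgradient psi idfun.

(* Determines [phiH] only up to an additive constant. *)
Definition H_functional {V : lmodType R} (phi : V -> \bar R) (j : V -> H)
    (phiH : H -> \bar R) : Prop :=
  [/\ forall u, -oo < phiH u, econvex phiH, edomain phiH !=set0,
      lower_semicontinuous phiH & j_subgradient phi j `<=` subgradient phiH].

End subgradient.

Section vector_valued_functions.
Context {R : realType} {H : normedModType R}.
Local Notation leb := (@lebesgue_measure R).
Implicit Types (D : set R) (s f u du : R -> H).

(* Lebesgue measure lives on Borel sets here; since all limits are taken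
   almost everywhere, this is strong measurability and Bochner integrability
   in the usual sense. *)
Definition bochner_simple D s : Prop :=
  [/\ finite_set (s @` D),
      forall h, measurable (D `&` s @^-1` [set h] : set (measurableTypeR R)) &
      forall h, h != 0 -> (leb (D `&` s @^-1` [set h]) < +oo)%E].

Definition bochner_simple_integral D s : H :=
  \sum_(h \in s @` D) fine (leb (D `&` s @^-1` [set h])) *: h.

Definition strongly_measurable D f : Prop :=
  exists2 s : nat -> R -> H, (forall n, bochner_simple D (s n)) &
    {ae leb, forall t, D t -> s ^~ t @ \oo --> f t}.

Definition is_bochner_integral D f (x : H) : Prop :=
  exists s : nat -> R -> H,
    [/\ forall n, bochner_simple D (s n),
        {ae leb, forall t, D t -> s ^~ t @ \oo --> f t},
        (\int[leb]_(t in D) `|s n t - f t|%:E)%E @[n --> \oo] --> 0%E &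
        bochner_simple_integral D (s n) @[n --> \oo] --> x].

Definition Loo_loc f : Prop :=
  strongly_measurable `]0, +oo[ f /\
  forall a b : R, 0 < a -> a < b ->
    exists M : R, {ae leb, forall t, a <= t <= b -> `|f t| <= M}.

Definition C1_test (eta : R -> R) : Prop :=
  [/\ forall t, derivable eta t 1, continuous (derive1 eta) &
      exists a b : R, 0 < a /\ forall t, ~~ (a <= t <= b) -> eta t = 0].

(* int eta' u = x and int eta du = - x on (0, +oo), as integrals in [H] *)
Definition weak_derivative u du : Prop := forall eta, C1_test eta ->
  exists x : H,
    is_bochner_integral `]0, +oo[ (fun t => derive1 eta t *: u t) x /\
    is_bochner_integral `]0, +oo[ (fun t => eta t *: du t) (- x).

(* membership of [u] in W^{1,oo}_loc((0, +oo); H), with witness [du] for its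
   a.e. unique weak derivative *)
Definition W1oo_loc u du : Prop :=
  [/\ Loo_loc u, Loo_loc du & weak_derivative u du].

End vector_valued_functions.

Section semigroup.
Context {d : measure_display} {T : measurableType d} {R : realType}.
Context {mu : {measure set T -> \bar R}}.
Local Notation H := (LspaceType2 mu).
Local Notation leb := (@lebesgue_measure R).

(* u' + d_j phi (u) contains 0 at a.e. t > 0, i.e. (u t, - u' t) is in d_j phi *)
Definition gradient_flow {V : lmodType R} (phi : V -> \bar R) (j : V -> H)
    (u0 : H) (u : R -> H) : Prop :=
  [/\ {within `[0, +oo[, continuous u}, u 0 = u0 &
      exists2 du : R -> H, W1oo_loc u du &
        {ae leb, forall t, 0 < t -> j_subgradient phi j (u t, - du t)}].

(* Only the values at times [t >= 0] are meaningful. *)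
Definition generated_semigroup {V : lmodType R} (phi : V -> \bar R)
    (j : V -> H) (S : R -> H -> H) : Prop :=
  forall u0, closure (j @` edomain phi) u0 ->
    gradient_flow phi j u0 (fun t => S t u0).

Definition leaves_invariant (S : R -> H -> H) (C : set H) : Prop :=
  forall t, 0 <= t -> S t @` C `<=` C.

Definition order_preserving_on (S : R -> H -> H) (C : set H) : Prop :=
  forall u v, C u -> C v -> (u <= v)%O ->
    forall t, 0 <= t -> (S t u <= S t v)%O.

End semigroup.

(* Main.v *)
Require Import Defs.
From HB Require Import structures.
From mathcomp Require Import all_boot all_order all_algebra.
From mathcomp Require Import all_classical all_reals all_analysis.
From mathcomp Require Import finmap unstable measurable_realfun hoelder.
From mathcomp Require Import ring lra.
Import Order.TTheory GRing.Theory Num.Theory.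
Import numFieldNormedType.Exports.
Local Open Scope classical_set_scope.
Local Open Scope ring_scope.
Set Implicit Arguments.
Unset Strict Implicit.
Unset Printing Implicit Defensive.

(** Write psi for the functional phiH on H = L^2 and w^+ for the join of w with
    0, so that the meet of u and v is u - (u - v)^+ and their join is
    v + (u - v)^+.

    assertion2 implies assertion1.  Put u(t) = S t u and v(t) = S t v.  Half
    the squared norm of (u - v)^+ has the derivative <u' - v', (u - v)^+> along
    the flow.  The subgradient inequality of psi at u(t), tested with the meet
    of u(t) and v(t), and at v(t), tested with their join, bounds this number
    by psi(meet) + psi(join) - psi(u(t)) - psi(v(t)), which assertion2 makes
    nonpositive.  So (u - v)^+ stays zero if it starts at zero.  The curves are
    only weakly differentiable; instead of a chain rule, the proof bounds the
    increments of <h, u(t)> for fixed h ([scalar_weak_derivative_le]) and adds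
    up the convexity inequality Phi y - Phi x <= <G y, y - x> over finer and
    finer partitions, on which the errors are quadratic
    ([increment_quadratic], [weak_curve_energy]).

    assertion1 implies assertion2.  Let p = (x - y)^+.  The pair z1 = x - p / 2,
    z2 = y + p / 2 is the projection of (x, y) on the set of ordered pairs, a
    set that the flow does not leave when started at (z1, z2).  Hence the
    distance from (S t z1, S t z2) to (x, y) is never smaller than at t = 0.
    The evolution variational inequality ([gradient_flow_evi]) would make it
    decrease if psi z1 + psi z2 exceeded psi x + psi y, whence
    psi z1 + psi z2 <= psi x + psi y ([order_preserving_midpoint]).  This pair
    is only halfway to the meet and the join of x and y.  But let X run along
    the segment from the meet of u1 and u2 to u1, and Y along the parallel
    segment from u2 to the join.  The projection of (X (s + h), Y (s - h)) is
    (X s, Y s), so F = psi o X and G = psi o Y satisfy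
    F s + G s <= F (s + h) + G (s - h).  These inequalities telescope to
    F h + G (1 - h) <= F 1 + G 0, and h tends to 0 by lower semicontinuity.

    assertion2 is equivalent to assertion3 because, up to an additive constant,
    psi u is the minimum of phi over the fiber j v = u
    ([H_functional_infimum]).  For large kappa the functional
    phi + kappa / 2 * |j - u|^2 has a minimizer by weak compactness, closed
    convex sets being weakly closed by the Hahn-Banach theorem
    ([closed_convex_weakly_closed]).  Minimizers give points of the
    j-subgradient, hence of the subgradient of psi, and when u moves along a
    segment the increments of phi and of psi o j along the minimizers differ
    by a quadratic error only.  So psi o j - phi has the same value at all of
    them ([gap_le]); letting kappa grow transfers this to all of H. *)

(** * Sublinear functionals and the separation of convex sets *)

Section HahnBanach.
Context {R : realType} {V : lmodType R}.
Implicit Types (p q : V -> R) (x y : V) (t m : R).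

Definition sublinear q : Prop :=
  (forall x y, q (x + y) <= q x + q y) /\
  (forall (t : R) x, 0 <= t -> q (t *: x) = t * q x).

Lemma sublinear0 q : sublinear q -> q 0 = 0.
Proof. by case=> _ /(_ 0 0 (lexx _)); rewrite scale0r mul0r. Qed.

Lemma sublinear_ge q x : sublinear q -> - q (- x) <= q x.
Proof.
move=> qsub; have := qsub.1 x (- x).
by rewrite subrr sublinear0//; lra.
Qed.

(** The largest sublinear functional below q that is at most - q y at - y. *)
Definition sublinear_slope q y x : R := inf [set q (x + t *: y) -
  t * q y | t in [set t : R | 0 <= t]].

Lemma sublinear_slope_lb q y x t : sublinear q -> 0 <= t ->
  - q (- x) <= q (x + t *: y) - t * q y.
Proof.
move=> [qD qZ] t0; rewrite -qZ// lerBrDr.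
by have := qD (x + t *: y) (- x); rewrite addrAC subrr add0r; lra.
Qed.

Lemma sublinear_slope_le q y x t : sublinear q -> 0 <= t ->
  sublinear_slope q y x <= q (x + t *: y) - t * q y.
Proof.
move=> qsub t0; apply: ge_inf; last by exists t.
by exists (- q (- x)) => _ [s s0 <-]; exact: sublinear_slope_lb.
Qed.

Lemma le_sublinear_slope q y x m :
  (forall t : R, 0 <= t -> m <= q (x + t *: y) - t * q y) -> m <= sublinear_slope q y x.
Proof.
move=> mle; apply: lb_le_inf; first by exists (q (x + 0 *: y) - 0 * q y); exists 0 => /=.
by move=> _ [t t0 <-]; exact: mle.
Qed.

(** Stability under this operation is what drives the Hahn-Banach theorem below: a
    minimal sublinear functional has to agree with all its slopes, and a
    functional that agrees with its slopes is additive. *)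
Lemma sublinear_slope_sub q y : sublinear q -> sublinear (sublinear_slope q y).
Proof.
move=> qsub; have [qD qZ] := qsub.
have qyD x1 x2 : sublinear_slope q y (x1 + x2) <=
    sublinear_slope q y x1 + sublinear_slope q y x2.
  rewrite -lerBlDr; apply: le_sublinear_slope => s s0.
  rewrite lerBlDr -lerBlDl; apply: le_sublinear_slope => t t0.
  rewrite lerBlDl (le_trans (sublinear_slope_le y (x1 + x2) qsub (addr_ge0 s0 t0)))//.
  have := qD (x1 + s *: y) (x2 + t *: y).
  by rewrite [in X in X -> _]addrACA scalerDl; lra.
have qy0 : sublinear_slope q y 0 = 0.
  apply/eqP; rewrite eq_le; apply/andP; split.
    have := sublinear_slope_le y 0 qsub (lexx 0).
    by rewrite scale0r addr0 mul0r subr0 (sublinear0 qsub).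
  by apply: le_sublinear_slope => t t0; rewrite add0r qZ// subrr.
have qyZ t x : 0 < t -> sublinear_slope q y (t *: x) <= t * sublinear_slope q y x.
  move=> t0; rewrite -ler_pdivrMl//; apply: le_sublinear_slope => s s0.
  rewrite ler_pdivrMl//.
  apply: le_trans (sublinear_slope_le y (t *: x) qsub (mulr_ge0 (ltW t0) s0)) _.
  by rewrite -scalerA -scalerDr (qZ _ _ (ltW t0)) -mulrA -mulrBr.
split=> // t x; rewrite le_eqVlt => /predU1P[<-|t0].
  by rewrite scale0r qy0 mul0r.
apply/eqP; rewrite eq_le qyZ//= -ler_pdivlMl//.
apply: le_trans (_ : sublinear_slope q y (t^-1 *: (t *: x)) <= _).
  by rewrite scalerA mulVf ?scale1r// gt_eqF.
by apply: qyZ; rewrite invr_gt0.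
Qed.

Lemma sublinear_slope_le_self q y x : sublinear q -> sublinear_slope q y x <= q x.
Proof.
move=> qsub; have := sublinear_slope_le y x qsub (lexx 0).
by rewrite scale0r addr0 mul0r subr0.
Qed.

Lemma sublinear_slope_oppr q y : sublinear q -> sublinear_slope q y (- y) <= - q y.
Proof.
move=> qsub; have := sublinear_slope_le y (- y) qsub ler01.
by rewrite scale1r addNr sublinear0// mul1r sub0r.
Qed.

(** By Zorn's lemma: the pointwise infimum of a chain is again sublinear, because
    it is bounded below by - p (- x), and because two members of a chain can be
    compared before their values at x and y are added. *)
Lemma minimal_sublinear p : sublinear p ->
  exists q, [/\ sublinear q, (forall x, q x <= p x) &
    forall r, sublinear r -> (forall x, r x <= q x) -> r = q].
Proof.
move=> psub; pose T := {q | sublinear q /\ forall x, q x <= p x}.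
pose below (q r : T) := `[< forall x, sval r x <= sval q x >].
have [||||[q [qsub qp]] qmin] := @Zorn T below.
- by move=> q; apply/asboolP.
- move=> q r s /asboolP rq /asboolP sr; apply/asboolP => x.
  exact: le_trans (rq x).
- move=> [q qP] [r rP] /asboolP /= rq /asboolP /= qr; apply: eq_exist.
  by apply/funext => x; apply/eqP; rewrite eq_le qr rq.
- move=> F Ftot; have [[q0 Fq0]|F0] := pselect (exists q : T, F q); last first.
    by exists (exist _ p (conj psub (fun x => lexx _))) => q Fq; case: F0; exists q.
  pose m x := inf [set sval q x | q in F].
  have mlb (q : T) x : F q -> m x <= sval q x.
    move=> Fq; apply: ge_inf; last by exists q.
    exists (- p (- x)) => _ [[r [rsub rp]] _ <-] /=.
    by apply: le_trans (sublinear_ge _ rsub); rewrite lerN2.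
  have lem x (c : R) : (forall q : T, F q -> c <= sval q x) -> c <= m x.
    move=> cq; apply: lb_le_inf; first by exists (sval q0 x); exists q0.
    by move=> _ [q Fq <-]; exact: cq.
  have msub : sublinear m.
    split=> [x y|t x t0].
      rewrite -lerBlDr; apply/lem => q Fq; rewrite lerBlDr -lerBlDl.
      apply/lem => r Fr; rewrite lerBlDl.
      have [/asboolP rq|/asboolP qr] := Ftot _ _ Fq Fr.
        apply: le_trans (mlb _ _ Fr) _.
        by apply: le_trans ((svalP r).1.1 x y) _; rewrite lerD2r rq.
      apply: le_trans (mlb _ _ Fq) _.
      by apply: le_trans ((svalP q).1.1 x y) _; rewrite lerD2l qr.
    move: t0; rewrite le_eqVlt => /predU1P[<-|t0].
      rewrite scale0r mul0r; apply/eqP; rewrite eq_le; apply/andP; split.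
        by rewrite -(sublinear0 (svalP q0).1) mlb.
      by apply/lem => q Fq; rewrite (sublinear0 (svalP q).1).
    have tge0 := ltW t0.
    apply/eqP; rewrite eq_le; apply/andP; split.
      rewrite -ler_pdivrMl//; apply/lem => q Fq.
      by rewrite ler_pdivrMl// -(svalP q).1.2// mlb.
    by apply/lem => q Fq; rewrite (svalP q).1.2// ler_wpM2l// mlb.
  have mp x : m x <= p x by apply: le_trans (mlb _ x Fq0) _; exact: (svalP q0).2.
  by exists (exist _ m (conj msub mp)) => q Fq; apply/asboolP => x; exact: mlb.
exists q; split=> // r rsub rq.
have rp x : r x <= p x by exact: le_trans (qp x).
have : below (exist _ q (conj qsub qp)) (exist _ r (conj rsub rp)).
  by apply/asboolP => x; exact: rq.
by move=> /qmin /(congr1 sval).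
Qed.

(** A minimal sublinear functional is linear, so no extension from a subspace has
    to be considered. *)
Lemma Hahn_Banach_sublinear p x0 : sublinear p ->
  exists f : {linear V -> R^o}, (forall x, f x <= p x) /\ p x0 <= f x0.
Proof.
move=> psub.
(* Starting from the slope in the direction x0 forces f (- x0) <= - p x0. *)
have [q [qsub qp qmin]] := minimal_sublinear (sublinear_slope_sub x0 psub).
have qD x y : q (x + y) = q x + q y.
  apply/eqP; rewrite eq_le qsub.1/=.
  have slopeE := qmin _ (sublinear_slope_sub y qsub)
    (fun z => sublinear_slope_le_self y z qsub).
  rewrite -[X in X x]slopeE -lerBrDr.
  by have := sublinear_slope_le y x qsub ler01; rewrite scale1r mul1r.
have qN x : q (- x) = - q x.
  by apply/eqP; rewrite -addr_eq0 -qD addNr sublinear0.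
have qlin : linear (q : V -> R^o).
  move=> t x y; rewrite qD; congr (_ + _).
  have [t0|/ltW t0] := leP 0 t; first by rewrite qsub.2.
  by rewrite -[t]opprK scaleNr qN qsub.2 ?oppr_ge0// scaleNr.
pose qL := GRing.isLinear.Build R V R^o *:%R q qlin.
pose f : {linear V -> R^o} := HB.pack (q : V -> R^o) qL.
exists f; split=> [x|/=].
  by apply: le_trans (qp x) _; exact: sublinear_slope_le_self.
rewrite -[q x0]opprK -qN lerNr.
by apply: le_trans (qp _) _; exact: sublinear_slope_oppr.
Qed.

End HahnBanach.

Section gauge.
Context {R : realType} {V : lmodType R} (A : set V).
Hypothesis A_convex : forall (x y : V) (t : R), A x -> A y -> 0 <= t <= 1 ->
  A (t *: x + (1 - t) *: y).
Hypothesis A_absorbing : forall x : V, exists2 r : R, 0 < r & A (r^-1 *: x).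
Hypothesis A0 : A 0.

(** The Minkowski functional of A. *)
Definition gauge (x : V) : R := inf [set r | 0 < r /\ A (r^-1 *: x)].

Lemma gauge_le (x : V) r : 0 < r -> A (r^-1 *: x) -> gauge x <= r.
Proof. by move=> r0 Ar; apply: ge_inf => //; exists 0 => s [/ltW]. Qed.

Lemma gauge_lt (x : V) r : gauge x < r -> 0 < r /\ A (r^-1 *: x).
Proof.
have xinf : has_inf [set r | 0 < r /\ A (r^-1 *: x)].
  by split; [have [s] := A_absorbing x; exists s|exists 0 => s [/ltW]].
move=> gr; have rg : 0 < r - gauge x by rewrite subr_gt0.
have [s [s0 As]] := inf_adherent rg xinf.
rewrite addrC subrK => sr; have r0 := lt_trans s0 sr; split=> //.
have := A_convex (t := s / r) As A0; rewrite scaler0 addr0 scalerA.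
rewrite mulrAC divff ?gt_eqF// mul1r; apply.
by rewrite (divr_ge0 (ltW s0) (ltW r0))/= ler_pdivrMr// mul1r ltW.
Qed.

Lemma gauge_sublinear : sublinear gauge.
Proof.
have gaugeZ (t : R) x : 0 < t -> gauge (t *: x) <= t * gauge x.
  move=> t0; rewrite -ler_pdivrMl//; apply/ler_gtP => r /gauge_lt[r0 Ar].
  rewrite ler_pdivrMl//; apply: gauge_le; first exact: mulr_gt0.
  by rewrite scalerA invfM mulrAC mulVf ?mul1r// gt_eqF.
have gauge0 : gauge 0 = 0.
  apply/eqP; rewrite eq_le; apply/andP; split.
    by apply/ler_gtP => r r0; apply: gauge_le => //; rewrite scaler0.
  by apply: lb_le_inf => [|r [/ltW]//]; have [r] := A_absorbing 0; exists r.
split=> [x y|t x].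
  apply/ler_gtP => c; rewrite -ltrBrDr => /midf_lt[].
  set s := _ / 2 => /gauge_lt[s0 As].
  rewrite ltrBrDr addrC -ltrBrDr => /gauge_lt[r0 Ar].
  have c0 : 0 < c by rewrite -(subrK s c) addr_gt0.
  apply: gauge_le => //.
  have := A_convex (t := s / c) As Ar; rewrite !scalerA.
  have -> : s / c * s^-1 = c^-1 by field; rewrite !gt_eqF.
  have -> : (1 - s / c) * (c - s)^-1 = c^-1.
    by field; rewrite !gt_eqF.
  rewrite -scalerDr; apply.
  by rewrite (divr_ge0 (ltW s0) (ltW c0))/= ler_pdivrMr// mul1r ltW// -subr_gt0.
rewrite le_eqVlt => /predU1P[<-|t0]; first by rewrite scale0r gauge0 mul0r.
apply/eqP; rewrite eq_le gaugeZ//= -ler_pdivlMl//.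
apply: le_trans (_ : gauge (t^-1 *: (t *: x)) <= _).
  by rewrite scalerA mulVf ?scale1r// gt_eqF.
by apply: gaugeZ; rewrite invr_gt0.
Qed.

End gauge.

Lemma convex_set_combination {R : realType} {V : lmodType R} (A : set V) :
  convex_set A -> forall (x y : V) (t : R), A x -> A y -> 0 <= t <= 1 ->
  A (t *: x + (1 - t) *: y).
Proof.
move=> Acvx x y t Ax Ay /andP[t0 t1].
by have /set_mem := Acvx _ _ (Itv01 t0 t1) (mem_set Ax) (mem_set Ay).
Qed.

Section separation.
Context {R : realType} {V : tvsType R}.

Lemma nbhs_subr (U : set V) (x : V) : nbhs 0 U -> \forall y \near x, U (y - x).
Proof.
move=> U0; have /= := @sub_continuous V (x, x) U;
  rewrite subrr => /(_ U0)[/= [B1 B2] [/= xB1 /nbhs_singleton xB2] BU].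
by apply: filterS xB1 => y yB1; exact: (BU (y, x)).
Qed.

Lemma nbhs_subl (U : set V) (x : V) : nbhs x U -> \forall w \near 0, U (x - w).
Proof.
move=> U0; have /= := @sub_continuous V (x, 0 : V) U;
  rewrite subr0 => /(_ U0)[/= [B1 B2] [/= /nbhs_singleton xB1 xB2] BU].
by apply: filterS xB2 => y yB2; exact: (BU (x, y)).
Qed.

Lemma nbhs0_scaler (U : set V) (s : R) : nbhs 0 U -> \forall y \near 0, U (s *: y).
Proof.
move=> U0; have /= := @scale_continuous R V (s : R^o, 0 : V) U;
  rewrite scaler0 => /(_ U0)[/= [B1 B2] [/= /nbhs_singleton xB1 xB2] BU].
by apply: filterS xB2 => y yB2; exact: (BU (s, y)).
Qed.

Lemma nbhs0_scalel (U : set V) (x : V) : nbhs 0 U -> \forall s \near (0 : R^o), U (s *: x).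
Proof.
move=> U0; have /= := @scale_continuous R V (0 : R^o, x) U;
  rewrite scale0r => /(_ U0)[/= [B1 B2] [/= xB1 /nbhs_singleton xB2] BU].
by apply: filterS xB1 => s sB1; exact: (BU (s, x)).
Qed.

(** The bound on U bounds f on a small multiple of U from above, and applied to
    both y - x and x - y it gives continuity at x. *)
Lemma tvs_linear_continuous (f : {linear V -> R^o}) (U : set V) :
  nbhs 0 U -> (forall x, U x -> f x <= 1) -> continuous f.
Proof.
move=> U0 fU x; apply/cvgrPdist_lt => e e0.
pose s := (e / 2)^-1; have s0 : 0 < s by rewrite invr_gt0 divr_gt0.
have small z : f (s *: z) <= 1 -> f z <= e / 2.
  by rewrite linearZ -ler_pdivlMl// mulr1 invrK.
near=> y.
have f1 : f (y - x) <= e / 2.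
  by apply: small; apply: fU; near: y; exact: nbhs_subr (nbhs0_scaler s U0).
have f2 : f (x - y) <= e / 2.
  apply: small; apply: fU; rewrite -opprB scalerN -scaleNr; near: y.
  exact: nbhs_subr (nbhs0_scaler (- s) U0).
rewrite ltr_norml; move: f1 f2; rewrite !linearB/= => f1 f2.
by apply/andP; split; lra.
Unshelve. all: by end_near. Qed.

(** Local convexity yields a convex U with K disjoint from x0 - U.  The gauge of
    K - k0 + U is at least 1 at x0 - k0, so the linear form that it dominates
    separates. *)
Lemma closed_convex_separation (K : set V) (x0 : V) : closed K ->
  (forall (x y : V) (t : R), K x -> K y -> 0 < t < 1 -> K (t *: x + (1 - t) *: y)) ->
  ~ K x0 ->
  exists (f : tvs_dual V) (r : R), r < sval f x0 /\ forall k, K k -> sval f k <= r.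
Proof.
move=> Kclosed Kcvx Kx0.
have [[k0 Kk0]|K0] := pselect (exists k, K k); last first.
  have cst0 : continuous (\0 : {linear V -> R^o}) by move=> x; exact: cvg_cst.
  by exists (exist _ _ cst0), (-1); split=> [/=|k Kk]; [exact: ltrN10|case: K0; exists k].
have {}Kcvx (x y : V) (t : R) : K x -> K y -> 0 <= t <= 1 -> K (t *: x + (1 - t) *: y).
  move=> Kx Ky /andP[]; rewrite !le_eqVlt => /predU1P[<-|t0] /predU1P[|t1].
  - by move/eqP; rewrite eq_sym oner_eq0.
  - by rewrite scale0r add0r subr0 scale1r.
  - by move=> ->; rewrite scale1r subrr scale0r addr0.
  - by apply: Kcvx; rewrite ?t0.
have [B Bcvx [Bopen Bbasis]] := @locally_convex R V.
have /Bbasis[W [BW Wx0] WK] : nbhs x0 (~` K).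
  by apply: open_nbhs_nbhs; split=> //; exact: closed_openC.
have Wcvx := convex_set_combination (Bcvx W (mem_set BW)).
pose U : set V := [set w | W (x0 - w)].
have U0 : nbhs 0 U.
  by apply: nbhs_subl; apply: open_nbhs_nbhs; split=> //; exact: Bopen.
have U00 : U 0 by exact: nbhs_singleton.
have Ucvx (x y : V) (t : R) : U x -> U y -> 0 <= t <= 1 -> U (t *: x + (1 - t) *: y).
  move=> Ux Uy t01; rewrite /U /=.
  have -> : x0 - (t *: x + (1 - t) *: y) = t *: (x0 - x) + (1 - t) *: (x0 - y).
    by rewrite !scalerBr addrACA -scalerDl [t + _]addrC subrK scale1r opprD.
  exact: Wcvx.
(* A is a convex neighborhood of 0 containing K - k0 but not x0 - k0. *)
pose A : set V := [set z | exists k w, [/\ K k, U w & z = (k - k0) + w]].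
have UA w : U w -> A w by move=> Uw; exists k0, w; rewrite subrr add0r.
have Acvx (x y : V) (t : R) : A x -> A y -> 0 <= t <= 1 -> A (t *: x + (1 - t) *: y).
  move=> [k [w [Kk Uw ->]]] [l [z [Kl Uz ->]]] t01.
  exists (t *: k + (1 - t) *: l), (t *: w + (1 - t) *: z).
  split; [exact: Kcvx|exact: Ucvx|].
  rewrite !scalerDr !scalerN addrACA; congr (_ + _).
  by rewrite addrACA -opprD -scalerDl [t + _]addrC subrK scale1r.
have Uabs (x : V) : exists2 r : R, 0 < r & U (r^-1 *: x).
  have /nbhs_ballP[e /= e0 eU] := nbhs0_scalel x U0.
  exists (e / 2)^-1; first by rewrite invr_gt0 divr_gt0.
  rewrite invrK; apply: eU; rewrite /ball /= sub0r normrN gtr0_norm ?divr_gt0//.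
  by rewrite ltr_pdivrMr// ltr_pMr// ltr1n.
have Aabs (x : V) : exists2 r : R, 0 < r & A (r^-1 *: x).
  by have [r r0 Ur] := Uabs x; exists r => //; exact: UA.
have A0 : A 0 by exact: UA.
have [f [fle fx]] := Hahn_Banach_sublinear (x0 - k0) (gauge_sublinear Acvx Aabs A0).
have fA z : A z -> f z <= 1.
  move=> Az; apply: le_trans (fle z) _; apply: gauge_le => //.
  by rewrite invr1 scale1r.
have fcont : continuous f.
  by apply: (tvs_linear_continuous U0) => x /UA /fA.
have f1 : 1 <= f (x0 - k0).
  apply: le_trans fx; rewrite leNgt; apply/negP.
  move=> /(gauge_lt Acvx Aabs A0)[_]; rewrite invr1 scale1r => -[k [w [Kk Uw]]].
  move=> /(congr1 (+%R^~ k0)); rewrite /= subrK [in RHS]addrAC subrK => x0kw.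
  by apply: (WK k) => //; move: Uw; rewrite /U /= x0kw addrK.
(* f is at most 1 on K - k0 + U, and U contains a vector on which f is at
   least r^-1: this leaves a gap of r^-1 between f on K and f x0. *)
have [r r0 Ur] := Uabs (x0 - k0).
have rV0 : 0 < r^-1 by rewrite invr_gt0.
exists (exist _ f fcont), (f k0 + 1 - r^-1) => /=; split=> [|k Kk].
  by move: f1; rewrite linearB/=; lra.
have /fA : A ((k - k0) + r^-1 *: (x0 - k0)) by exists k, (r^-1 *: (x0 - k0)).
rewrite linearD/= linearZ/= linearB/= => fk.
have : r^-1 * 1 <= r^-1 *: f (x0 - k0) by rewrite ler_wpM2l// invr_ge0 ltW.
by rewrite mulr1; move: fk; lra.
Qed.

Lemma closed_convex_weakly_closed (K : set V) : closed K ->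
  (forall (x y : V) (t : R), K x -> K y -> 0 < t < 1 -> K (t *: x + (1 - t) *: y)) ->
  closed (K : set (weak V)).
Proof.
move=> Kclosed Kcvx; rewrite -openC; rewrite openE => x0 /= Kx0.
have [f [r [rf fK]]] := closed_convex_separation Kclosed Kcvx Kx0.
have : nbhs (x0 : weak V) [set y : weak V | r < sval f y].
  apply: (@weak_continuous R V f x0 [set z | r < z]).
  exact: lt_nbhsr.
by apply: filterS => y /= ry Ky; have := fK y Ky; rewrite leNgt ry.
Qed.

End separation.

(** * The inner product of L^2 *)

Section ae_Rintegral.
Context {d : measure_display} {T : measurableType d} {R : realType}.
Variable mu : {measure set T -> \bar R}.

Lemma ae_eq_Rintegral (D : set T) (f g : T -> R) : measurable D ->
  measurable_fun D f -> measurable_fun D g ->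
  {ae mu, forall x, D x -> f x = g x} ->
  \int[mu]_(x in D) f x = \int[mu]_(x in D) g x.
Proof.
move=> mD mf mg fg; congr fine; apply: ae_eq_integral => //.
- exact/measurable_EFinP.
- exact/measurable_EFinP.
- by apply: filterS fg => x fgx Dx /=; rewrite fgx.
Qed.

(** The difference g - f is almost everywhere equal to its positive part. *)
Lemma ae_le_Rintegral (D : set T) (f g : T -> R) : measurable D ->
  mu.-integrable D (EFin \o f) -> mu.-integrable D (EFin \o g) ->
  {ae mu, forall x, D x -> f x <= g x} ->
  \int[mu]_(x in D) f x <= \int[mu]_(x in D) g x.
Proof.
move=> mD intf intg fg.
have mf : measurable_fun D f by apply/measurable_EFinP; exact: (measurable_int mu).
have mg : measurable_fun D g by apply/measurable_EFinP; exact: (measurable_int mu).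
rewrite -subr_ge0 -RintegralB//.
rewrite (@ae_eq_Rintegral _ _ (fun x => Num.max (g x - f x) 0))//.
- by apply: Rintegral_ge0 => x _; rewrite le_max lexx orbT.
- exact: measurable_funB.
- by apply: measurable_maxr => //; exact: measurable_funB.
- by apply: filterS fg => x fgx Dx; rewrite max_l// subr_ge0 fgx.
Qed.

End ae_Rintegral.

Section inner_product.
Context {d : measure_display} {T : measurableType d} {R : realType}.
Context {mu : {measure set T -> \bar R}}.
Local Notation H := (LspaceType2 mu).
Implicit Types (u v w : H) (a : R).
Local Notation "<| u , v |>" := (L2_inner u v).

Lemma L2_addE u v : {ae mu, forall x, (u + v : H) x = u x + v x}.
Proof. by apply: filterS (LspaceDE u v) => x /(_ I). Qed.

Lemma L2_oppE u : {ae mu, forall x, (- u : H) x = - u x}.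
Proof. by apply: filterS (LspaceNE u) => x /(_ I). Qed.

Lemma L2_scaleE a u : {ae mu, forall x, (a *: u : H) x = a * u x}.
Proof. by apply: filterS (LspaceZE a u) => x /(_ I). Qed.

Lemma L2_subE u v : {ae mu, forall x, (u - v : H) x = u x - v x}.
Proof. by apply: filterS2 (L2_addE u (- v)) (L2_oppE v) => x -> ->. Qed.

Lemma L2_meetE u v : {ae mu, forall x, (u `&` v : H)%O x = Num.min (u x) (v x)}.
Proof. by apply: filterS (Lspace_meetE u v) => x /(_ I). Qed.

Lemma L2_joinE u v : {ae mu, forall x, (u `|` v : H)%O x = Num.max (u x) (v x)}.
Proof. by apply: filterS (Lspace_joinE u v) => x /(_ I). Qed.

Lemma L2_zeroE : {ae mu, forall x, (0 : H) x = 0}.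
Proof.
rewrite -[0](scale0r (0 : H)); apply: filterS (L2_scaleE 0 0) => x ->.
by rewrite mul0r.
Qed.

Lemma L2_eqP u v : {ae mu, forall x, u x = v x} -> u = v.
Proof. by move=> uv; apply/LspaceP; apply: filterS uv. Qed.

Lemma L2_integrable u v : mu.-integrable setT (EFin \o (fun x => u x * v x)).
Proof. by apply/Lfun1_integrable/Lfun2_mul_Lfun1; exact: Lrepr_in. Qed.

Lemma L2_measurable u v : measurable_fun setT (fun x => u x * v x).
Proof. by apply/measurable_EFinP; exact: measurable_int (L2_integrable u v). Qed.

Lemma L2_innerC u v : <|u, v|> = <|v, u|>.
Proof. by apply: eq_Rintegral => x _; rewrite mulrC. Qed.

Lemma L2_innerDl u v w : <|u + v, w|> = <|u, w|> + <|v, w|>.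
Proof.
rewrite /L2_inner -RintegralD//; [|exact: L2_integrable..].
apply: ae_eq_Rintegral => //; first exact: L2_measurable.
  by apply: measurable_funD; exact: L2_measurable.
by apply: filterS (L2_addE u v) => x -> _; rewrite mulrDl.
Qed.

Lemma L2_innerZl a u w : <|a *: u, w|> = a * <|u, w|>.
Proof.
rewrite /L2_inner -RintegralZl//; last exact: L2_integrable.
apply: ae_eq_Rintegral => //; first exact: L2_measurable.
  by apply: measurable_funM => //; exact: L2_measurable.
by apply: filterS (L2_scaleE a u) => x -> _; rewrite mulrA.
Qed.

Lemma L2_innerDr u v w : <|w, u + v|> = <|w, u|> + <|w, v|>.
Proof. by rewrite !(L2_innerC w) L2_innerDl. Qed.

Lemma L2_innerZr a u w : <|w, a *: u|> = a * <|w, u|>.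
Proof. by rewrite !(L2_innerC w) L2_innerZl. Qed.

Lemma L2_innerNl u w : <|- u, w|> = - <|u, w|>.
Proof. by rewrite -scaleN1r L2_innerZl mulN1r. Qed.

Lemma L2_innerNr u w : <|w, - u|> = - <|w, u|>.
Proof. by rewrite !(L2_innerC w) L2_innerNl. Qed.

Lemma L2_innerBl u v w : <|u - v, w|> = <|u, w|> - <|v, w|>.
Proof. by rewrite L2_innerDl L2_innerNl. Qed.

Lemma L2_innerBr u v w : <|w, u - v|> = <|w, u|> - <|w, v|>.
Proof. by rewrite !(L2_innerC w) L2_innerBl. Qed.

Lemma L2_inner0l u : <|0, u|> = 0.
Proof. by rewrite -(scale0r (0 : H)) L2_innerZl mul0r. Qed.

Lemma L2_inner0r u : <|u, 0|> = 0.
Proof. by rewrite L2_innerC L2_inner0l. Qed.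

Lemma L2_inner_linear u : linear (L2_inner u : H -> R^o).
Proof. by move=> a v w; rewrite L2_innerDr L2_innerZr. Qed.

HB.instance Definition _ u :=
  GRing.isLinear.Build R H R^o *:%R (L2_inner u : H -> R^o) (@L2_inner_linear u).

Lemma L2_normD u v : `|u + v| ^+ 2 = `|u| ^+ 2 + 2 * <|u, v|> + `|v| ^+ 2.
Proof.
by rewrite -!L2_inner_norm L2_innerDl !L2_innerDr (L2_innerC v u); ring.
Qed.

Lemma L2_normB u v : `|u - v| ^+ 2 = `|u| ^+ 2 - 2 * <|u, v|> + `|v| ^+ 2.
Proof. by rewrite L2_normD L2_innerNr normrN; ring. Qed.

(** Expand the square of | |v| u - |u| v |. *)
Lemma L2_cauchy_schwarz u v : <|u, v|> <= `|u| * `|v|.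
Proof.
have [->|u0] := eqVneq u 0; first by rewrite L2_inner0l normr0 mul0r.
have [->|v0] := eqVneq v 0; first by rewrite L2_inner0r normr0 mulr0.
have := sqr_ge0 (Num.norm (`| v | *: u - `| u | *: v)).
rewrite L2_normB L2_innerZl L2_innerZr !normrZ !normr_id !exprMn.
have nu : 0 < `|u| by rewrite normr_gt0.
have nv : 0 < `|v| by rewrite normr_gt0.
have nuv := mulr_gt0 nu nv => h.
rewrite -(ler_pM2l nuv).
by move: h; lra.
Qed.

Lemma L2_norm_inner u v : `|<|u, v|>| <= `|u| * `|v|.
Proof.
rewrite ler_norml L2_cauchy_schwarz andbT lerNl -L2_innerNl.
by rewrite (le_trans (L2_cauchy_schwarz _ _))// normrN.
Qed.

Lemma L2_inner_continuous u : continuous (L2_inner u : H -> R^o).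
Proof.
pose U : set H := [set v | L2_inner u v <= 1].
apply: (@tvs_linear_continuous R H (L2_inner u) U) => //.
apply/nbhs_ballP; exists (`|u| + 1)^-1 => /=.
  by rewrite invr_gt0 ltr_wpDl.
move=> v; rewrite -ball_normE /= sub0r normrN => vu.
rewrite /U/= (le_trans (L2_cauchy_schwarz u v))//.
apply: (@le_trans _ _ ((`|u| + 1) * `|v|)).
  by rewrite ler_wpM2r// lerDl.
by rewrite mulrC -ler_pdivlMr ?ltr_wpDl// mul1r ltW.
Qed.

(** The convexity inequality for half the squared distance to c, whose gradient at
    y is y - c. *)
Lemma L2_sq_dist_energy (c x y : H) :
  `|y - c| ^+ 2 / 2 - `|x - c| ^+ 2 / 2 <= L2_inner (y - c) (y - x).
Proof.
have -> : y - x = (y - c) - (x - c) by rewrite opprB addrA subrK.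
have := sqr_ge0 (Num.norm ((y - c) - (x - c))).
by rewrite (L2_normB (y - c)) L2_innerBr -L2_inner_norm; lra.
Qed.

End inner_product.

(** * Positive parts in L^2 *)

Section lattice.
Context {d : measure_display} {T : measurableType d} {R : realType}.
Context {mu : {measure set T -> \bar R}}.
Local Notation H := (LspaceType2 mu).
Implicit Types (u v w x y z p q : H) (a : R).
Local Notation "<| u , v |>" := (L2_inner u v).

Definition L2_pos w : H := (w `|` 0)%O.

Lemma L2_posE w : {ae mu, forall t, L2_pos w t = Num.max (w t) 0}.
Proof. by apply: filterS2 (L2_joinE w 0) (@L2_zeroE _ _ _ mu) => t -> ->. Qed.

Lemma L2_inner_le u v w z :
  {ae mu, forall t, u t * v t <= w t * z t} -> <|u, v|> <= <|w, z|>.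
Proof.
move=> uvwz; apply: ae_le_Rintegral => //; [exact: L2_integrable..|].
by apply: filterS uvwz.
Qed.

Lemma L2_meet_pos u v : (u `&` v)%O = u - L2_pos (u - v).
Proof.
apply: L2_eqP; near=> t.
have -> : (u `&` v : H)%O t = Num.min (u t) (v t) by near: t; exact: L2_meetE.
have -> : (u - L2_pos (u - v)) t = u t - L2_pos (u - v) t by near: t; exact: L2_subE.
have -> : L2_pos (u - v) t = Num.max ((u - v) t) 0 by near: t; exact: L2_posE.
have -> : (u - v) t = u t - v t by near: t; exact: L2_subE.
by case: (lerP (u t) (v t)) => uv; case: (lerP (u t - v t) 0) => uv0; lra.
Unshelve. all: by end_near. Qed.

Lemma L2_join_pos u v : (u `|` v)%O = v + L2_pos (u - v).
Proof.
apply: L2_eqP; near=> t.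
have -> : (u `|` v : H)%O t = Num.max (u t) (v t) by near: t; exact: L2_joinE.
have -> : (v + L2_pos (u - v)) t = v t + L2_pos (u - v) t by near: t; exact: L2_addE.
have -> : L2_pos (u - v) t = Num.max ((u - v) t) 0 by near: t; exact: L2_posE.
have -> : (u - v) t = u t - v t by near: t; exact: L2_subE.
by case: (lerP (u t) (v t)) => uv; case: (lerP (u t - v t) 0) => uv0; lra.
Unshelve. all: by end_near. Qed.

Lemma L2_le_pos u v : (u <= v)%O <-> L2_pos (u - v) = 0.
Proof.
rewrite leEmeet L2_meet_pos; split.
  by move/eqP/(congr1 (fun z => u - z)); rewrite subrr opprB addrC subrK.
by move=> ->; rewrite subr0 eqxx.
Qed.

(** Half the squared norm of the positive part is convex, with gradient L2_pos. *)
Lemma L2_pos_energy x y :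
  `|L2_pos y| ^+ 2 / 2 - `|L2_pos x| ^+ 2 / 2 <= <|L2_pos y, y - x|>.
Proof.
have h1 : <|L2_pos y, L2_pos y|> <= <|L2_pos y, y|>.
  apply: L2_inner_le; apply: filterS (L2_posE y) => t ->.
  by case: (lerP (y t) 0) => yt; nra.
have h2 : <|L2_pos y, x|> <= <|L2_pos y, L2_pos x|>.
  apply: L2_inner_le; apply: filterS2 (L2_posE y) (L2_posE x) => t -> ->.
  by case: (lerP (y t) 0) => yt; case: (lerP (x t) 0) => xt; nra.
have := sqr_ge0 `|L2_pos y - L2_pos x|.
rewrite L2_normB -!L2_inner_norm L2_innerBr.
by move: h1 h2; lra.
Qed.

Lemma L2_pos_nonexpansive x y : `|L2_pos y - L2_pos x| <= `|y - x|.
Proof.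
rewrite -(@ler_pXn2r _ 2) ?nnegrE//= -!L2_inner_norm.
apply: L2_inner_le; near=> t.
have -> : (L2_pos y - L2_pos x) t = L2_pos y t - L2_pos x t by near: t; exact: L2_subE.
have -> : (y - x) t = y t - x t by near: t; exact: L2_subE.
have -> : L2_pos y t = Num.max (y t) 0 by near: t; exact: L2_posE.
have -> : L2_pos x t = Num.max (x t) 0 by near: t; exact: L2_posE.
case: (lerP (y t) 0) => yt; case: (lerP (x t) 0) => xt //.
- by rewrite subrr mul0r -expr2 sqr_ge0.
- by have := mulr_le0_ge0 yt (ltW xt); have := sqr_ge0 (y t); lra.
- by have := mulr_ge0_le0 (ltW yt) xt; have := sqr_ge0 (x t); lra.
Unshelve. all: by end_near. Qed.

(** The pairs (x, y) lie at distance |L2_pos (x - y)| / sqrt 2 from the closed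
    convex set of ordered pairs. *)
Lemma L2_le_dist_pos x y u v : (u <= v)%O ->
  `|L2_pos (x - y)| ^+ 2 / 2 <= `|u - x| ^+ 2 + `|v - y| ^+ 2.
Proof.
move=> /Lspace_leP uv.
have h : `|L2_pos (x - y)| ^+ 2 <= `|(u - x) - (v - y)| ^+ 2.
  rewrite -!L2_inner_norm; apply: L2_inner_le; near=> t.
  have -> : L2_pos (x - y) t = Num.max ((x - y) t) 0 by near: t; exact: L2_posE.
  have -> : (x - y) t = x t - y t by near: t; exact: L2_subE.
  have -> : ((u - x) - (v - y)) t = (u - x) t - (v - y) t by near: t; exact: L2_subE.
  have -> : (u - x) t = u t - x t by near: t; exact: L2_subE.
  have -> : (v - y) t = v t - y t by near: t; exact: L2_subE.
  have : u t <= v t by near: t.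
  case: (lerP (x t - y t) 0) => xt uv'; first by rewrite mul0r -expr2 sqr_ge0.
  have uv0 : 0 <= v t - u t by rewrite subr_ge0.
  by have := mulr_ge0 (ltW xt) uv0; have := sqr_ge0 (v t - u t); lra.
have := sqr_ge0 (Num.norm ((u - x) + (v - y))).
by rewrite (L2_normD (u - x) (v - y)); move: h; rewrite (L2_normB (u - x) (v - y)); lra.
Unshelve. all: by end_near. Qed.

(** L2_pos w and L2_pos (- w) are supported on disjoint sets. *)
Lemma L2_pos_disjoint (s : R) w : 0 <= s ->
  L2_pos (s *: L2_pos w - L2_pos (- w)) = s *: L2_pos w.
Proof.
move=> s0; apply: L2_eqP; near=> t.
rewrite (_ : L2_pos (s *: _ - _) t = Num.max ((s *: L2_pos w - L2_pos (- w)) t) 0);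
  last by near: t; exact: L2_posE.
have -> : (s *: L2_pos w - L2_pos (- w)) t = (s *: L2_pos w) t - L2_pos (- w) t.
  by near: t; exact: L2_subE.
have -> : (s *: L2_pos w) t = s * L2_pos w t by near: t; exact: L2_scaleE.
have -> : L2_pos w t = Num.max (w t) 0 by near: t; exact: L2_posE.
have -> : L2_pos (- w) t = Num.max ((- w) t) 0 by near: t; exact: L2_posE.
have -> : (- w) t = - w t by near: t; exact: L2_oppE.
case: (lerP (w t) 0) => wt; case: (lerP (- w t) 0) => wt';
  case: lerP => h; nra.
Unshelve. all: by end_near. Qed.

(** The two sides form the projection of (x, y) on the set of ordered pairs. *)
Lemma L2_midpoint_le (x y : H) :
  (x - 2^-1 *: L2_pos (x - y) <= y + 2^-1 *: L2_pos (x - y))%O.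
Proof.
apply/L2_le_pos.
have -> : x - 2^-1 *: L2_pos (x - y) - (y + 2^-1 *: L2_pos (x - y)) =
    (x - y) - L2_pos (x - y).
  rewrite opprD addrACA -opprD -scalerDl.
  by rewrite (_ : 2^-1 + 2^-1 = 1 :> R) ?scale1r//; lra.
by apply/L2_le_pos; rewrite /L2_pos leUl.
Qed.

End lattice.

(** * Bochner integrals tested against a vector *)

(** The real line is a measurable space under several names; this instance serves
    the one over which the Bochner integrals are taken. *)
#[local] Instance lebesgue_ae_filter {R : realType} :
  Filter (nbhs (almost_everywhere (@lebesgue_measure R))).
Proof. exact: (ae_filter_ringOfSetsType (@lebesgue_measure R)). Qed.

Section integrals.
Context {d : measure_display} {T : measurableType d} {R : realType}.
Variable mu : {measure set T -> \bar R}.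

(** The integral of a nonnegative function is a supremum over the simple functions
    below it, so it is monotone without measurability.  The functions
    |s n t - f t| in the definition of the Bochner integral are only almost
    everywhere equal to Borel functions. *)
Lemma ge0_le_integral_nonmeasurable (D : set T) (f g : T -> \bar R) :
  (forall x, D x -> 0 <= f x)%E -> (forall x, D x -> f x <= g x)%E ->
  (\int[mu]_(x in D) f x <= \int[mu]_(x in D) g x)%E.
Proof.
move=> f0 fg; have g0 x : D x -> (0 <= g x)%E.
  by move=> Dx; exact: le_trans (f0 x Dx) (fg x Dx).
rewrite !ge0_integralE//; apply: le_ereal_sup => _ [h /= hf <-].
exists h => //= x; apply: le_trans (hf x) _.
by rewrite /patch; case: ifPn => // /set_mem; exact: fg.
Qed.

Lemma simple_integrable (I : eqType) (r : seq I) (A : I -> set T) (c : I -> R)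
    (D : set T) : measurable D ->
  (forall i, i \in r -> measurable (A i)) -> (forall i, i \in r -> A i `<=` D) ->
  (forall i, i \in r -> c i != 0 -> (mu (A i) < +oo)%E) ->
  mu.-integrable D (EFin \o (fun t => \sum_(i <- r) c i * \1_(A i) t)%R) /\
  (\int[mu]_(t in D) (\sum_(i <- r) c i * \1_(A i) t) =
   \sum_(i <- r) c i * fine (mu (A i)))%R.
Proof.
move=> mD; elim: r => [|i r IHr] mA AD Afin.
  split; first by under eq_fun do rewrite /= big_nil; exact: integrable0.
  by under eq_Rintegral do rewrite big_nil; rewrite big_nil Rintegral_cst// mul0r.
have [intr Er] : mu.-integrable D (EFin \o (fun t => \sum_(i <- r) c i * \1_(A i) t)%R) /\
  (\int[mu]_(t in D) (\sum_(i <- r) c i * \1_(A i) t) =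
   \sum_(i <- r) c i * fine (mu (A i)))%R.
  by apply: IHr => j jr; [apply: mA|apply: AD|apply: Afin]; rewrite inE jr orbT.
have mAi : measurable (A i) by apply: mA; rewrite inE eqxx.
have ADi : A i `<=` D by apply: AD; rewrite inE eqxx.
have int1 : c i != 0 -> mu.-integrable D (EFin \o \1_(A i)).
  move=> c0; apply/integrableP; split; first by apply/measurable_EFinP.
  under eq_integral do rewrite /= ger0_norm//.
  rewrite integral_indic// setIidl//.
  by apply: Afin => //; rewrite inE eqxx.
have inti : mu.-integrable D (EFin \o (fun t => c i * \1_(A i) t)%R).
  have [c0|c0] := eqVneq (c i) 0%R.
    by under eq_fun do rewrite /= c0 mul0r; exact: integrable0.
  by move: (int1 c0) => /(integrableZl mD (c i)); apply: eq_integrable.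
have Ei : (\int[mu]_(t in D) (c i * \1_(A i) t) = c i * fine (mu (A i)))%R.
  have [->|c0] := eqVneq (c i) 0%R.
    by under eq_Rintegral do rewrite mul0r; rewrite Rintegral_cst// !mul0r.
  rewrite RintegralZl//; last exact: int1.
  by rewrite /Rintegral integral_indic// setIidl.
split.
  have := integrableD mD inti intr; apply: eq_integrable => // t _ /=.
  by rewrite big_cons EFinD.
under eq_Rintegral do rewrite big_cons.
by rewrite RintegralD// Ei Er big_cons.
Qed.

End integrals.

Section bochner.
Context {d : measure_display} {T : measurableType d} {R : realType}.
Context {mu : {measure set T -> \bar R}}.
Local Notation H := (LspaceType2 mu).
Local Notation leb := (@lebesgue_measure R).
Local Notation MR := (measurableTypeR R).
Implicit Types (D : set R) (s f : R -> H) (h x : H).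

Lemma bochner_simple_inner D s h : measurable (D : set (measurableTypeR R)) ->
  bochner_simple D s ->
  leb.-integrable D (EFin \o (fun t => L2_inner h (s t))) /\
  \int[leb]_(t in D) L2_inner h (s t) = L2_inner h (bochner_simple_integral D s).
Proof.
move=> mD [fins ms levs].
pose r : seq H := fset_set (s @` D).
pose A v : set (measurableTypeR R) := D `&` s @^-1` [set v].
have rP v : (v \in r) = (v \in s @` D) by rewrite in_fset_set.
have E t : D t -> L2_inner h (s t) = \sum_(v <- r) L2_inner h v * \1_(A v) t.
  move=> Dt; have str : s t \in r by rewrite rP; apply/mem_set; exists t.
  rewrite (bigD1_seq (s t)) ?fset_uniq//=.
  rewrite big1 ?addr0 => [|v /negbTE vst].
    by rewrite indicE mem_set ?mulr1.
  rewrite indicE memNset ?mulr0// => -[_ /= stv].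
  by rewrite stv eqxx in vst.
have [||||intE intv] := @simple_integrable _ _ _ leb H r A (L2_inner h) D.
- by [].
- by move=> v _; exact: ms.
- by move=> v _ z [Dz _].
- move=> v _ hv; apply: levs; apply: contra_neq hv => ->.
  by rewrite L2_inner0r.
split.
  by apply: eq_integrable intE => // t /set_mem Dt /=; rewrite E.
transitivity (\int[leb]_(t in D) \sum_(v <- r) L2_inner h v * \1_(A v) t).
  by apply: eq_Rintegral => t /set_mem; exact: E.
rewrite intv.
rewrite /bochner_simple_integral fsbig_finite//= raddf_sum/=.
by apply: eq_bigr => v _; rewrite L2_innerZr mulrC.
Qed.

(** Bochner integrals commute with inner products.  The function <h, f t> need not
    be Borel, hence the version g. *)
Lemma bochner_inner D f x h : measurable (D : set MR) ->
  is_bochner_integral D f x ->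
  exists g : MR -> R, [/\ leb.-integrable D (EFin \o g),
    {ae leb, forall t, D t -> g t = L2_inner h (f t)} &
    \int[leb]_(t in D) g t = L2_inner h x].
Proof.
move=> mD [s [ss [N [mN N0 NP]] sf sx]].
(* Off the null set N everything is measurable; p n and g vanish on N. *)
pose E : set MR := D `\` N.
have mE : measurable E by exact: measurableD.
have sfE t : E t -> s ^~ t @ \oo --> f t.
  move=> [Dt Nt]; apply: contrapT => nsf; apply: Nt; apply: NP => /= sft.
  exact: nsf (sft Dt).
have aeE : {ae leb, forall t, D t -> E t}.
  exists N; split=> // t /= DEt; apply: contrapT => Nt; apply: DEt => Dt.
  by split.
pose p n : MR -> R := (fun t : MR => L2_inner h (s n t)) \_ E.
pose g : MR -> R := (fun t : MR => L2_inner h (f t)) \_ E.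
have mp0 n : measurable_fun (D : set MR) (fun t : MR => L2_inner h (s n t)).
  by apply/measurable_EFinP; have [/measurable_int] := bochner_simple_inner h mD (ss n).
have mp n : measurable_fun (D : set MR) (p n).
  by apply/measurable_restrict => //; apply: measurable_funS (mp0 n).
have mg : measurable_fun (D : set MR) g.
  apply/measurable_restrict => //.
  apply: (measurable_fun_cvg (h := fun n t => L2_inner h (s n t))) => [n|t [_ Et]].
    by apply: measurable_funS (mp0 n).
  apply: continuous_cvg; last exact: sfE.
  exact: L2_inner_continuous.
(* The 1 keeps c invertible when h is zero. *)
pose c := `|h| + 1; have c0 : 0 < c by rewrite ltr_wpDl.
have pgle n t : D t -> `|p n t - g t| <= c * `|s n t - f t|.
  move=> Dt; rewrite /p /g /patch; case: ifPn => Et; last first.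
    by rewrite subrr normr0 mulr_ge0// ltW.
  rewrite -L2_innerBr; apply: (@le_trans _ _ (`|h| * `|s n t - f t|)); last first.
    by rewrite ler_wpM2r// lerDl.
  exact: L2_norm_inner.
pose e n : \bar R := (\int[leb]_(t in D) `|s n t - f t|%:E)%E.
have pg_int n : (\int[leb]_(t in D) (`|p n t - g t|)%:E <= c%:E * e n)%E.
  rewrite -lee_pdivrMl// -ge0_integralZl_EFin//; last 2 first.
  - by apply/measurable_EFinP; apply: measurableT_comp => //; exact: measurable_funB.
  - by rewrite invr_ge0 ltW.
  apply: ge0_le_integral_nonmeasurable => t Dt.
    by rewrite -EFinM lee_fin mulr_ge0// invr_ge0 ltW.
  by rewrite -EFinM lee_fin ler_pdivrMl// pgle.
have [efin e_cvg] := (fine_cvgP e 0).1 sf.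
have intp n : leb.-integrable D (EFin \o p n).
  have [ints _] := bochner_simple_inner h mD (ss n).
  apply: (le_integrable mD _ _ ints); first by apply/measurable_EFinP; exact: mp.
  move=> t Dt /=; rewrite lee_fin /p /patch; case: ifPn => // _.
  by rewrite normr0.
have intpE n : \int[leb]_(t in D) p n t = L2_inner h (bochner_simple_integral D (s n)).
  rewrite -(bochner_simple_inner h mD (ss n)).2.
  apply: ae_eq_Rintegral => //; apply: filterS aeE => t DEt Dt.
  by rewrite /p /patch mem_set//; exact: DEt.
have intpg n : e n \is a fin_num -> leb.-integrable D (EFin \o (fun t => p n t - g t)).
  move=> en; apply/integrableP; split.
    by apply/measurable_EFinP; exact: measurable_funB.
  apply: le_lt_trans (pg_int n) _.
  by rewrite -(fineK en) -EFinM ltry.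
have intg : leb.-integrable D (EFin \o g).
  have [n _ /(_ n (leqnn n)) en] := efin.
  have := integrableB mD (intp n) (intpg n en).
  by apply: eq_integrable => // t _ /=; rewrite -EFinB opprB addrC subrK.
exists g; split=> //.
  by apply: filterS aeE => t DEt Dt; rewrite /g /patch mem_set//; exact: DEt.
have close : \forall n \near \oo,
    `|\int[leb]_(t in D) p n t - \int[leb]_(t in D) g t| <= c * fine (e n).
  apply: filterS efin => n; rewrite -/(e n) => en.
  rewrite -RintegralB//; apply: le_trans (le_normr_Rintegral mD (intpg n en)) _.
  have -> : c * fine (e n) = fine (c%:E * e n)%E by rewrite fineM.
  apply: fine_le; last exact: pg_int.
    apply: integrable_fin_num => //.
    by apply: (integrable_norm (intpg n en)).
  by rewrite fin_numM.
have cvgg : (fun n => \int[leb]_(t in D) p n t) @ \oo --> \int[leb]_(t in D) g t.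
  have ce_cvg : (fun n => c * fine (e n)) @ \oo --> c * 0.
    by apply: cvgM; [exact: cvg_cst|exact: e_cvg].
  apply/cvgrPdist_le => eps eps0; near=> n.
  have ce_eps : `|c * 0 - c * fine (e n)| <= eps.
    by near: n; move/cvgrPdist_le: ce_cvg; apply.
  rewrite distrC; apply: (@le_trans _ _ (c * fine (e n))); first by near: n.
  by apply: le_trans ce_eps; rewrite mulr0 sub0r normrN ler_norm.
have cvgx : (fun n => \int[leb]_(t in D) p n t) @ \oo --> L2_inner h x.
  under eq_fun do rewrite intpE.
  apply: continuous_cvg; last exact: sx.
  exact: L2_inner_continuous.
exact: cvg_unique cvgg cvgx.
Unshelve. all: by end_near. Qed.

End bochner.

(** * C^1 cut-off functions *)

Section smoothstep.
Context {R : realType}.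
Implicit Types (x t a e : R).

(** x |-> (x^+)^2 is convex and its derivative 2 x^+ is 2-Lipschitz; stated as a
    bound on the Taylor remainder, this makes differentiability uniform in the
    sign of x. *)
Lemma sqr_pos_remainder x h :
  `|Num.max (x + h) 0 ^+ 2 - Num.max x 0 ^+ 2 - 2 * Num.max x 0 * h| <= h ^+ 2.
Proof.
rewrite ler_norml.
case: (lerP x 0) => x0; case: (lerP (x + h) 0) => xh0; apply/andP; split; nra.
Qed.

Lemma is_derive_sqr_pos x :
  is_derive x 1 (fun y : R => Num.max y 0 ^+ 2) (2 * Num.max x 0).
Proof.
have cvgq : (fun h : R => h^-1 *: (Num.max (h *: 1 + x) 0 ^+ 2 - Num.max x 0 ^+ 2)) @ 0^'
    --> 2 * Num.max x 0.
  apply/cvgrPdist_le => eps eps0; near=> h.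
  have h0 : h != 0 by near: h; exact: nbhs_dnbhs_neq.
  have hn : `|h| != 0 by rewrite normr_eq0.
  have heps : `|h| <= eps.
    near: h; apply: dnbhs0_le => //.
  rewrite /GRing.scale /= mulr1 (addrC h) distrC.
  apply: le_trans heps.
  have -> : h^-1 * (Num.max (x + h) 0 ^+ 2 - Num.max x 0 ^+ 2) - 2 * Num.max x 0 =
    h^-1 * (Num.max (x + h) 0 ^+ 2 - Num.max x 0 ^+ 2 - 2 * Num.max x 0 * h) by field.
  rewrite normrM normfV ler_pdivrMl ?normr_gt0//.
  by rewrite -expr2 real_normK ?num_real// sqr_pos_remainder.
split; first by apply/cvg_ex; exists (2 * Num.max x 0).
exact: (cvg_lim _ cvgq).
Unshelve. all: by end_near. Qed.

(** The second difference of (x^+)^2 with step e / 2, normalized to rise from 0 at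
    a to 1 at a + e: the simplest C^1 function of this shape. *)
Definition smoothstep a e t : R := 2 / e ^+ 2 *
  (Num.max (t - a) 0 ^+ 2 - 2 * Num.max (t - (a + e / 2)) 0 ^+ 2 + Num.max (t -
    (a + e)) 0 ^+ 2).

(** The tent function, derivative of [smoothstep]. *)
Definition dsmoothstep a e t : R := 4 / e ^+ 2 *
  (Num.max (t - a) 0 - 2 * Num.max (t - (a + e / 2)) 0 + Num.max (t - (a + e)) 0).

Lemma is_derive_smoothstep a e t : is_derive t 1 (smoothstep a e) (dsmoothstep a e t).
Proof.
have shift c : is_derive t 1 (fun y : R => Num.max (y - c) 0 ^+ 2) (2 * Num.max (t - c) 0).
  have dq := is_derive_sqr_pos (t - c).
  have ds : is_derive t 1 (fun y : R => y - c) 1.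
    by apply: is_derive_eq; rewrite subr0.
  have := @is_derive1_comp _ (fun y : R => Num.max y 0 ^+ 2) _ t _ _ dq ds.
  by rewrite mulr1.
have d1 := shift a; have d2 := shift (a + e / 2); have d3 := shift (a + e).
rewrite /smoothstep; apply: is_derive_eq.
rewrite /dsmoothstep /GRing.scale/=; ring.
Qed.

Lemma smoothstep_continuous a e : continuous (smoothstep a e).
Proof.
move=> t; have d := is_derive_smoothstep a e t.
by apply/differentiable_continuous/derivable1_diffP; exact: ex_derive.
Qed.

Lemma dsmoothstep_continuous a e : continuous (dsmoothstep a e).
Proof.
have pos_cont (c : R) : continuous (fun t : R => Num.max (t - c) 0).
  move=> t; apply: (@continuous_max _ _ (fun t : R => t - c) (fun=> 0)).
    by apply: cvgB; [exact: cvg_id|exact: cvg_cst].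
  exact: cvg_cst.
move=> t; apply: cvgM; first exact: cvg_cst.
apply: cvgD; last exact: pos_cont.
by apply: cvgB; [exact: pos_cont|apply: cvgM; [exact: cvg_cst|exact: pos_cont]].
Qed.

Lemma dsmoothstep_ge0 a e t : 0 < e -> 0 <= dsmoothstep a e t.
Proof.
move=> e0; rewrite mulr_ge0 ?divr_ge0 ?sqr_ge0//.
by case: (lerP (t - a) 0) => ?; case: (lerP (t - (a + e / 2)) 0) => ?;
  case: (lerP (t - (a + e)) 0) => ?; lra.
Qed.

Lemma dsmoothstep_eq0 a e t : 0 < e -> ~~ (a <= t <= a + e) -> dsmoothstep a e t = 0.
Proof.
move=> e0; rewrite negb_and -!ltNge /dsmoothstep => tae.
rewrite (_ : _ + _ = 0) ?mulr0//.
by case: (lerP (t - a) 0) => ?; case: (lerP (t - (a + e / 2)) 0) => ?;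
  case: (lerP (t - (a + e)) 0) => ?; case/orP: tae => ?; lra.
Qed.

Lemma smoothstep_eq0 a e t : 0 < e -> t <= a -> smoothstep a e t = 0.
Proof.
move=> e0 ta; rewrite /smoothstep.
by rewrite !max_r ?expr0n/= ?mulr0 ?subr0 ?addr0 ?mulr0//; lra.
Qed.

Lemma smoothstep_eq1 a e t : 0 < e -> a + e <= t -> smoothstep a e t = 1.
Proof.
move=> e0 ta; rewrite /smoothstep !max_l; [|lra..].
by field; rewrite gt_eqF.
Qed.

Lemma smoothstep_bounds a e t : 0 < e -> 0 <= smoothstep a e t <= 1.
Proof.
move=> e0; have e20 : 0 < e ^+ 2 by rewrite exprn_gt0.
rewrite /smoothstep mulrAC ler_pdivrMr// mul1r divr_ge0 ?(ltW e20)//=.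
  case: (lerP (t - a) 0) => ?; case: (lerP (t - (a + e / 2)) 0) => ?;
    case: (lerP (t - (a + e)) 0) => ?; nra.
case: (lerP (t - a) 0) => ?; case: (lerP (t - (a + e / 2)) 0) => ?;
  case: (lerP (t - (a + e)) 0) => ?; nra.
Qed.

End smoothstep.

(** * Growth bounds from scalar weak derivatives *)

Section weak_derivative_bound.
Context {R : realType}.
Local Notation MR := (measurableTypeR R).
Local Notation leb := (@lebesgue_measure R).
Local Notation Ipos := (`]0, +oo[%classic : set MR).

(** f is the weak derivative of F on the positive half-line.  The functions g1 and
    g2 are Borel versions of the two integrands, which need not be Borel. *)
Definition scalar_weak_derivative (F f : R -> R) : Prop :=
  forall eta : R -> R, C1_test eta -> exists g1 g2 : MR -> R,
    [/\ leb.-integrable Ipos (EFin \o g1) /\ leb.-integrable Ipos (EFin \o g2),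
        {ae leb, forall t, Ipos t -> g1 t = derive1 eta t * F t},
        {ae leb, forall t, Ipos t -> g2 t = eta t * f t} &
        \int[leb]_(t in Ipos) g1 t = - \int[leb]_(t in Ipos) g2 t].

Lemma integral_cst_itv (c l r : R) : 0 < l -> l <= r ->
  leb.-integrable Ipos (EFin \o (fun t : MR => c * \1_(`[l, r]%classic : set MR) t)) /\
  \int[leb]_(t in Ipos) (c * \1_(`[l, r]%classic : set MR) t) = c * (r - l).
Proof.
move=> l0 lr.
have lebE : leb (`[l, r]%classic : set MR) = (r - l)%:E.
  by rewrite lebesgue_measure_itv/= lte_fin; case: ltgtP lr => // -> _; rewrite subrr.
have [||||] := @simple_integrable _ _ _ leb unit [:: tt] (fun=> `[l,
  r]%classic) (fun=> c) Ipos.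
- exact: measurable_itv.
- by move=> *; exact: measurable_itv.
- move=> _ _ t /=; rewrite !in_itv/= andbT => /andP[+ _].
  exact: lt_le_trans.
- by move=> _ _ _; apply: (eq_ind_r (fun z => (z < +oo)%E) _ lebE); exact: ltry.
move=> intc valc; split.
  by apply: eq_integrable intc; [exact: measurable_itv|move=> t _ /=; rewrite big_seq1].
move: valc; rewrite big_seq1 (congr1 fine lebE) /= => <-.
by apply: eq_Rintegral => t _; rewrite big_seq1.
Qed.

(** The fundamental theorem of calculus on [a, a + e], outside of which the
    integrand vanishes. *)
Lemma integral_dsmoothstep (a e : R) : 0 < a -> 0 < e ->
  leb.-integrable Ipos (EFin \o (dsmoothstep a e : MR -> R)) /\
  \int[leb]_(t in Ipos) dsmoothstep a e t = 1.
Proof.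
move=> a0 e0; have ae : a < a + e by rewrite ltrDl.
have mI : measurable Ipos by exact: measurable_itv.
have maeI : measurable (`[a, a + e]%classic : set MR) by exact: measurable_itv.
have contin : {within `[a, a + e], continuous (dsmoothstep a e)}.
  exact/continuous_subspaceT/dsmoothstep_continuous.
have aeI : `[a, a + e]%classic `<=` Ipos.
  by move=> t /=; rewrite !in_itv/= andbT => /andP[+ _]; exact: lt_le_trans.
have E : dsmoothstep a e = (dsmoothstep a e) \_ `[a, a + e]%classic.
  apply/funext => t; rewrite /patch; case: ifPn => // tae.
  by rewrite dsmoothstep_eq0//; apply: contra tae => tae; apply/mem_set; rewrite /= in_itv.
have int0 : leb.-integrable (`[a,
  a + e]%classic : set MR) (EFin \o (dsmoothstep a e : MR -> R)).
  by apply: continuous_compact_integrable => //; exact: segment_compact.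
split.
  have : leb.-integrable (Ipos `&` `[a,
    a + e]%classic) (EFin \o (dsmoothstep a e : MR -> R)).
    by rewrite setIidr.
  move=> /(integrable_restrict leb maeI mI); apply: eq_integrable => // t _ /=.
  by rewrite [in RHS]E /patch; case: ifPn.
have -> : \int[leb]_(t in Ipos) dsmoothstep a e t = \int[leb]_(t in `[a,
  a + e]) dsmoothstep a e t.
  by rewrite [in LHS]E -Rintegral_mkcondr setIidr.
rewrite /Rintegral (@continuous_FTC2 _ _ (smoothstep a e))//=; first last.
- move=> t _; rewrite derive1E.
  by have d := is_derive_smoothstep a e t; rewrite derive_val.
- split.
  + by move=> t _; have d := is_derive_smoothstep a e t; exact: ex_derive.
  + exact/cvg_at_right_filter/smoothstep_continuous.
  + exact/cvg_at_left_filter/smoothstep_continuous.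
by rewrite smoothstep_eq1// smoothstep_eq0// subr0.
Qed.

Definition plateau (a b e t : R) : R := smoothstep a e t - smoothstep (b - e) e t.

Lemma derive_plateau a b e : derive1 (plateau a b e) =
  fun t => dsmoothstep a e t - dsmoothstep (b - e) e t.
Proof.
apply/funext => t; rewrite derive1E.
have d1 := is_derive_smoothstep a e t; have d2 := is_derive_smoothstep (b - e) e t.
exact: derive_val.
Qed.

Lemma plateau_eq0 a b e t : 0 < e -> a + e <= b - e -> ~~ (a <= t <= b) ->
  plateau a b e t = 0.
Proof.
move=> e0 aeb; rewrite negb_and -!ltNge /plateau => /orP[ta|tb].
  by rewrite !smoothstep_eq0 ?subr0//; lra.
by rewrite !smoothstep_eq1 ?subrr//; lra.
Qed.

Lemma plateau_eq1 a b e t : 0 < e -> a + e <= t <= b - e -> plateau a b e t = 1.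
Proof.
move=> e0 /andP[at_ tb]; rewrite /plateau.
by rewrite smoothstep_eq1// smoothstep_eq0// subr0.
Qed.

Lemma C1_test_plateau a b e : 0 < a -> 0 < e -> a + e <= b - e ->
  C1_test (plateau a b e).
Proof.
move=> a0 e0 aeb; split.
- move=> t; apply: derivableB.
    by have d := is_derive_smoothstep a e t; exact: ex_derive.
  by have d := is_derive_smoothstep (b - e) e t; exact: ex_derive.
- rewrite derive_plateau => t.
  by apply: cvgB; exact: dsmoothstep_continuous.
- by exists a, b; split=> // t; exact: plateau_eq0.
Qed.

Lemma plateau_bounds a b e t : 0 < e -> a + e <= b - e -> 0 <= plateau a b e t <= 1.
Proof.
move=> e0 aeb; rewrite /plateau.
have := smoothstep_bounds a t e0; have := smoothstep_bounds (b - e) t e0.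
have [tb|bt] := leP t (b - e).
  by rewrite (smoothstep_eq0 e0 tb) subr0.
by rewrite (@smoothstep_eq1 _ a)//; lra.
Qed.

(** Test the weak derivative with a plateau that rises to 1 right after a and
    descends to 0 right before b.  Its derivative turns the integral of F into an
    approximation of F a - F b, and the integral of f against it is at most about
    K * (b - a). *)
Lemma scalar_weak_derivative_le (F f : R -> R) (a b K : R) :
  scalar_weak_derivative F f -> 0 < a -> a < b ->
  {for a, continuous F} -> {for b, continuous F} ->
  {ae leb, forall t, a <= t <= b -> f t <= K} ->
  F b - F a <= K * (b - a).
Proof.
move=> Ff a0 ab Fa Fb fK; apply/ler_addgt0Pr => delta delta0.
pose D := delta / 3; have D0 : 0 < D by rewrite divr_gt0.
have [ra /= ra0 raF] : exists2 r : R, 0 < r & forall t, `|a - t| < r -> `|F a - F t| <= D.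
  have /cvgrPdist_le/(_ D D0) := Fa => /nbhs_ballP[r /= r0 rF].
  by exists r => // t tr; apply: rF.
have [rb /= rb0 rbF] : exists2 r : R, 0 < r & forall t, `|b - t| < r -> `|F b - F t| <= D.
  have /cvgrPdist_le/(_ D D0) := Fb => /nbhs_ballP[r /= r0 rF].
  by exists r => // t tr; apply: rF.
have [e [e0 era erb eab eK]] : exists e : R,
    [/\ 0 < e, e < ra, e < rb, a + e <= b - e & `|K| * (2 * e) <= D].
  pose e1 := D / (2 * (`|K| + 1)).
  have K1 : 0 < `|K| + 1 by rewrite ltr_wpDl.
  have e10 : 0 < e1 by rewrite divr_gt0// mulr_gt0.
  exists (Num.min (Num.min (ra / 2) (rb / 2)) (Num.min ((b - a) / 2) e1)).
  set e := Num.min _ _.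
  have e_ra : e <= ra / 2 by rewrite /e !ge_min lexx.
  have e_rb : e <= rb / 2 by rewrite /e !ge_min lexx !orbT.
  have e_ab : e <= (b - a) / 2 by rewrite /e !ge_min lexx !orbT.
  have e_K : e <= e1 by rewrite /e !ge_min lexx !orbT.
  have e0 : 0 < e.
    by rewrite /e !lt_min e10 !divr_gt0 ?subr_gt0.
  split=> //; [lra..|].
  have : e * (2 * (`|K| + 1)) <= D by rewrite -ler_pdivlMr// mulr_gt0.
  by lra.
have mI : measurable Ipos by exact: measurable_itv.
have [g1 [g2 [[int1 int2] g1E g2E g12]]] := Ff _ (C1_test_plateau a0 e0 eab).
have [intsa valsa] := integral_dsmoothstep a0 e0.
have be0 : 0 < b - e by lra.
have [intsb valsb] := integral_dsmoothstep be0 e0.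
(* F is at most F a + D where the plateau rises and at least F b - D where it
   descends, and each of the two slopes has integral one. *)
have upper1 : \int[leb]_(t in Ipos) g1 t <= F a - F b + 2 * D.
  have intA : leb.-integrable Ipos (EFin \o (fun t : MR => (F a + D) * dsmoothstep a e t)).
    by have := integrableZl mI (F a + D) intsa; apply: eq_integrable.
  have intB : leb.-integrable Ipos (EFin \o (fun t : MR => (F b - D) * dsmoothstep (b -
    e) e t)).
    by have := integrableZl mI (F b - D) intsb; apply: eq_integrable.
  apply: (@le_trans _ _ (\int[leb]_(t in Ipos)
      ((F a + D) * dsmoothstep a e t - (F b - D) * dsmoothstep (b - e) e t))).
    apply: ae_le_Rintegral => //; first by have := integrableB mI intA intB;
      apply: eq_integrable.
    apply: filterS g1E => t g1t It; rewrite g1t// derive_plateau mulrBl lerB//.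
      have [tae|tae] := boolP (a <= t <= a + e); last first.
        by rewrite dsmoothstep_eq0// mul0r mulr0.
      rewrite mulrC ler_wpM2r ?dsmoothstep_ge0//.
      have /raF : `|a - t| < ra by rewrite ltr_norml; move: tae; lra.
      by rewrite ler_norml; lra.
    have [tbe|tbe] := boolP (b - e <= t <= b - e + e); last first.
      by rewrite dsmoothstep_eq0// mul0r mulr0.
    rewrite [leRHS]mulrC ler_wpM2r ?dsmoothstep_ge0//.
    have /rbF : `|b - t| < rb by rewrite ltr_norml; move: tbe; lra.
    by rewrite ler_norml; lra.
  have valA : \int[leb]_(t in Ipos) ((F a + D) * dsmoothstep a e t) = F a + D.
    by rewrite RintegralZl// valsa mulr1.
  have valB : \int[leb]_(t in Ipos) ((F b - D) * dsmoothstep (b - e) e t) = F b - D.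
    by rewrite RintegralZl// valsb mulr1.
  by rewrite RintegralB// valA valB; lra.
(* K * plateau is at most K on [a, b] if K >= 0, and at most K on
   [a + e, b - e] if K < 0; the choice of e pays for the difference. *)
have upper2 : \int[leb]_(t in Ipos) g2 t <= K * (b - a) + D.
  have [K0|K0] := leP 0 K.
    have [intK valK] := integral_cst_itv K a0 (ltW ab).
    apply: (@le_trans _ _ (K * (b - a))); last by rewrite lerDl ltW.
    rewrite -valK; apply: ae_le_Rintegral => //.
    apply: filterS2 g2E fK => t g2t ftK It; rewrite g2t//.
    have /andP[p0 p1] := plateau_bounds t e0 eab.
    have [tab|tab] := boolP (a <= t <= b); last first.
      by rewrite plateau_eq0// mul0r mulr_ge0.
    rewrite indicE mem_set ?mulr1; last by rewrite /= in_itv.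
    have [f0|f0] := leP 0 (f t); first by apply: le_trans (ftK tab); rewrite ler_piMl.
    by apply: le_trans K0; rewrite mulr_ge0_le0// ltW.
  have [intK valK] := integral_cst_itv K (addr_gt0 a0 e0) eab.
  apply: (@le_trans _ _ (K * (b - e - (a + e)))); last first.
    by move: eK; rewrite ltr0_norm//; lra.
  rewrite -valK; apply: ae_le_Rintegral => //.
  apply: filterS2 g2E fK => t g2t ftK It; rewrite g2t//.
  have /andP[p0 p1] := plateau_bounds t e0 eab.
  rewrite indicE; have [/set_mem /= |tab'] := boolP (t \in _).
    rewrite in_itv/= mulr1 => tab'; rewrite plateau_eq1// mul1r; apply: ftK.
    by move: tab'; lra.
  rewrite mulr0; have [tab|tab] := boolP (a <= t <= b); last first.
    by rewrite plateau_eq0// mul0r.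
  by rewrite mulr_ge0_le0// (le_trans (ftK tab))// ltW.
move: g12 upper1 upper2 => ->; rewrite /D; lra.
Qed.

End weak_derivative_bound.

(** * Energy inequalities along weakly differentiable curves *)

(** An error quadratic in the length of the interval disappears under refinement. *)
Lemma increment_quadratic {R : realType} (f : R -> R) (a b K C : R) :
  a <= b -> 0 <= C ->
  (forall s t, a <= s -> s <= t -> t <= b -> f t - f s <= K * (t - s) + C * (t - s) ^+ 2) ->
  f b - f a <= K * (b - a).
Proof.
move=> ab C0 fst.
(* Cutting an interval in two halves the quadratic error. *)
have half n s t : a <= s -> s <= t -> t <= b ->
    f t - f s <= K * (t - s) + C / 2 ^+ n * (t - s) ^+ 2.
  elim: n s t => [|n IHn] s t as_ st tb; first by rewrite expr0 divr1; exact: fst.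
  pose m := (s + t) / 2.
  have sm : s <= m by rewrite /m; lra.
  have mt : m <= t by rewrite /m; lra.
  have h1 := IHn s m as_ sm (le_trans mt tb).
  have h2 := IHn m t (le_trans as_ sm) mt tb.
  have -> : C / 2 ^+ n.+1 * (t - s) ^+ 2 =
     C / 2 ^+ n * (m - s) ^+ 2 + C / 2 ^+ n * (t - m) ^+ 2.
    by rewrite exprS /m; field; rewrite expf_neq0.
  by move: h1 h2; rewrite /m; lra.
apply/ler_addgt0Pr => e e0.
have C1 : 0 <= C * (b - a) ^+ 2 / e.
  by apply: divr_ge0; [apply: mulr_ge0 => //; exact: sqr_ge0|exact: ltW].
have [n Cn] : exists n : nat, C * (b - a) ^+ 2 / e <= 2 ^+ n.
  exists (Num.truncn (C * (b - a) ^+ 2 / e)).+1.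
  apply: le_trans (ltW (truncnS_gt _)) _.
  by rewrite -natrX ler_nat ltnW// ltn_expl.
apply: le_trans (half n a b (lexx _) ab (lexx _)) _.
rewrite lerD2l mulrAC ler_pdivrMr ?exprn_gt0//.
by rewrite [leRHS]mulrC -ler_pdivrMr.
Qed.

Section curves.
Context {d : measure_display} {T : measurableType d} {R : realType}.
Context {mu : {measure set T -> \bar R}}.
Local Notation H := (LspaceType2 mu).
Local Notation leb := (@lebesgue_measure R).
Local Notation MR := (measurableTypeR R).
Implicit Types (h : H) (w dw : R -> H).

Lemma weak_derivative_inner w dw h : weak_derivative w dw ->
  scalar_weak_derivative (fun t => L2_inner h (w t)) (fun t => L2_inner h (dw t)).
Proof.
move=> wdw eta /wdw[x [bw bdw]].
have mI : measurable (`]0, +oo[%classic : set MR) by exact: measurable_itv.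
have [g1 [int1 g1E v1]] := bochner_inner h mI bw.
have [g2 [int2 g2E v2]] := bochner_inner h mI bdw.
exists g1, g2; split=> //.
- by apply: filterS g1E => t g1t /g1t ->; rewrite L2_innerZr.
- by apply: filterS g2E => t g2t /g2t ->; rewrite L2_innerZr.
- by rewrite v1 v2 L2_innerNr opprK.
Qed.

Lemma scalar_weak_derivativeB (F f G g : R -> R) :
  scalar_weak_derivative F f -> scalar_weak_derivative G g ->
  scalar_weak_derivative (fun t => F t - G t) (fun t => f t - g t).
Proof.
move=> Ff Gg eta eta1.
have mI : measurable (`]0, +oo[%classic : set MR) by exact: measurable_itv.
have [f1 [f2 [[intf1 intf2] f1E f2E f12]]] := Ff eta eta1.
have [g1 [g2 [[intg1 intg2] g1E g2E g12]]] := Gg eta eta1.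
exists (fun t => f1 t - g1 t), (fun t => f2 t - g2 t); split.
- split.
  + by have := integrableB mI intf1 intg1; apply: eq_integrable.
  + by have := integrableB mI intf2 intg2; apply: eq_integrable.
- by apply: filterS2 f1E g1E => t ft gt It; rewrite ft// gt// mulrBr.
- by apply: filterS2 f2E g2E => t ft gt It; rewrite ft// gt// mulrBr.
- by rewrite !RintegralB// f12 g12 opprD.
Qed.

(** The properties of a solution of the gradient flow that the energy estimates
    use; they are stable under differences. *)
Definition weak_curve w dw : Prop :=
  [/\ forall h, scalar_weak_derivative (fun t => L2_inner h (w t)) (fun t => L2_inner h
    (dw t)),
      {within `[0, +oo[, continuous w} &
      forall a b, 0 < a -> a < b ->
        exists M : R, {ae leb, forall t, a <= t <= b -> `|dw t| <= M}].

Lemma weak_curveB w1 dw1 w2 dw2 : weak_curve w1 dw1 -> weak_curve w2 dw2 ->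
  weak_curve (fun t => w1 t - w2 t) (fun t => dw1 t - dw2 t).
Proof.
move=> [wd1 c1 M1] [wd2 c2 M2]; split.
- move=> h eta /(scalar_weak_derivativeB (wd1 h) (wd2 h))[g1 [g2 [ints g1E g2E g12]]].
  exists g1, g2; split=> //.
    by apply: filterS g1E => t g1t /g1t ->; rewrite L2_innerBr.
  by apply: filterS g2E => t g2t /g2t ->; rewrite L2_innerBr.
- by move=> t; apply: cvgB; [exact: c1|exact: c2].
- move=> a b a0 ab; have [m1 m1E] := M1 a b a0 ab; have [m2 m2E] := M2 a b a0 ab.
  exists (m1 + m2); apply: filterS2 m1E m2E => t m1t m2t tab.
  by rewrite (le_trans (ler_normB _ _))// lerD ?m1t ?m2t.
Qed.

Lemma weak_curve_continuous w dw t : weak_curve w dw -> 0 < t -> {for t, continuous w}.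
Proof.
move=> [_ /continuous_within_itvcyP[wc _] _] t0.
by apply: wc; rewrite in_itv/= t0.
Qed.

Lemma weak_curve_continuous0 w dw : weak_curve w dw -> w @ 0^'+ --> w 0.
Proof. by move=> [_ /continuous_within_itvcyP[]]. Qed.

Lemma weak_curve_le w dw h (a b K : R) : weak_curve w dw -> 0 < a -> a <= b ->
  {ae leb, forall t, a <= t <= b -> L2_inner h (dw t) <= K} ->
  L2_inner h (w b - w a) <= K * (b - a).
Proof.
move=> wdw a0; rewrite le_eqVlt => /predU1P[->|ab] dwK.
  by rewrite !subrr mulr0 L2_inner0r.
have [wd _ _] := wdw; rewrite L2_innerBr.
have hw t : 0 < t -> {for t, continuous (fun s => L2_inner h (w s))}.
  move=> t0; apply: (@continuous_comp _ _ _ w (L2_inner h : H -> R^o)).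
    exact: weak_curve_continuous wdw t0.
  exact: L2_inner_continuous.
exact: scalar_weak_derivative_le (wd h) a0 ab (hw a a0) (hw b (lt_trans a0 ab)) dwK.
Qed.

(** Test [weak_curve_le] with h = w t - w s. *)
Lemma weak_curve_lipschitz w dw (a b M s t : R) : weak_curve w dw -> 0 < a ->
  0 <= M -> {ae leb, forall r, a <= r <= b -> `|dw r| <= M} -> a <= s -> s <= t -> t <= b ->
  `|w t - w s| <= M * (t - s).
Proof.
move=> wdw a0 M0 dwM as_ st tb.
have [->|wts] := eqVneq (w t - w s) 0.
  by rewrite normr0 mulr_ge0// subr_ge0.
have h0 : 0 < `|w t - w s| by rewrite normr_gt0.
rewrite -(ler_pM2l h0) -expr2 -L2_inner_norm mulrA.
apply: (weak_curve_le wdw (lt_le_trans a0 as_) st).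
apply: filterS dwM => r dwr srt.
apply: le_trans (L2_cauchy_schwarz _ _) _.
rewrite ler_wpM2l// dwr//; move: srt; lra.
Qed.

(** On a short interval [s, t], convexity bounds the increment of Phi o w by
    <G (w t), w t - w s>, where G (w t) is a fixed vector; replacing it by
    G (w r) under the integral costs at most M^2 * (t - s) since G and w are
    Lipschitz. *)
Lemma weak_curve_energy w dw (Phi : H -> R) (G : H -> H) (a b K : R) :
  weak_curve w dw ->
  (forall x y, Phi y - Phi x <= L2_inner (G y) (y - x)) ->
  (forall x y, `|G y - G x| <= `|y - x|) ->
  0 < a -> a < b ->
  {ae leb, forall t, a <= t <= b -> L2_inner (G (w t)) (dw t) <= K} ->
  Phi (w b) - Phi (w a) <= K * (b - a).
Proof.
move=> wdw PhiG G1 a0 ab GK.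
have [_ _ /(_ a b a0 ab)[M0 dwM0]] := wdw.
pose M := Num.max M0 0; have Mge0 : 0 <= M by rewrite le_max lexx orbT.
have dwM : {ae leb, forall t, a <= t <= b -> `|dw t| <= M}.
  by apply: filterS dwM0 => t dwt /dwt dwM; rewrite le_max dwM.
apply: (@increment_quadratic _ (Phi \o w) _ _ _ (M ^+ 2)) => [||s t as_ st tb].
- exact: ltW.
- exact: sqr_ge0.
apply: le_trans (PhiG _ _) _; rewrite [X in _ <= _ + X]mulrA -mulrDl.
apply: (weak_curve_le wdw (lt_le_trans a0 as_) st).
have dwM' := dwM; apply: filterS2 GK dwM' => r GKr dwMr /andP[sr rt].
have rab : a <= r <= b by rewrite (le_trans as_ sr) (le_trans rt tb).
rewrite -[G (w t)](subrK (G (w r))) L2_innerDl addrC lerD ?GKr//.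
apply: le_trans (L2_cauchy_schwarz _ _) _.
rewrite expr2 mulrAC ler_pM ?dwMr//.
apply: le_trans (G1 _ _) _.
apply: le_trans (weak_curve_lipschitz wdw a0 Mge0 dwM (le_trans as_ sr) rt tb) _.
by rewrite ler_wpM2l// lerB.
Qed.

(** The bound extends to the initial time: convexity bounds Phi (w a) - Phi (w 0)
    from above by a quantity that tends to 0 with w a - w 0. *)
Lemma weak_curve_energy0 w dw (Phi : H -> R) (G : H -> H) (b K : R) :
  weak_curve w dw ->
  (forall x y, Phi y - Phi x <= L2_inner (G y) (y - x)) ->
  (forall x y, `|G y - G x| <= `|y - x|) ->
  0 < b ->
  {ae leb, forall t, 0 < t <= b -> L2_inner (G (w t)) (dw t) <= K} ->
  Phi (w b) - Phi (w 0) <= K * b.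
Proof.
move=> wdw PhiG G1 b0 GK; apply/ler_addgt0Pr => e e0.
have w0 := weak_curve_continuous0 wdw.
pose c := `|G (w 0)| + 1 + `|K| + 1.
have c0 : 0 < c by rewrite ltr_wpDl// !addr_ge0.
have /cvgrPdist_le wcvg := w0.
have ec0 : 0 < Num.min 1 (e / (2 * c)) by rewrite lt_min ltr01 divr_gt0// mulr_gt0.
have := wcvg _ ec0 => wnear.
have [a [a0 ab ae wa]] : exists a : R, [/\ 0 < a, a < b, a <= e / (2 * c) &
    `|w 0 - w a| <= Num.min 1 (e / (2 * c))].
  near (0 : R)^'+ => a; exists a; split; near: a => //.
  - exact: nbhs_right_gt.
  - exact: nbhs_right_lt.
  - by apply: nbhs_right_le; rewrite divr_gt0// mulr_gt0.
have h1 : Phi (w b) - Phi (w a) <= K * (b - a).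
  apply: (weak_curve_energy wdw PhiG G1 a0 ab).
  by apply: filterS GK => t Kt /andP[at_ tb]; rewrite Kt// tb (lt_le_trans a0).
have /andP[wa1 wae] : (`|w 0 - w a| <= 1) && (`|w 0 - w a| <= e / (2 * c)).
  by rewrite -le_min.
have h2 : Phi (w a) - Phi (w 0) <= (`|G (w 0)| + 1) * (e / (2 * c)).
  apply: le_trans (PhiG _ _) _; apply: le_trans (L2_cauchy_schwarz _ _) _.
  rewrite ler_pM//; last by rewrite distrC.
  rewrite -[G (w a)](subrK (G (w 0))) addrC (le_trans (ler_normD _ _))// lerD2l.
  by rewrite (le_trans (G1 _ _))// distrC.
have h3 : - (K * a) <= `|K| * (e / (2 * c)).
  rewrite -mulNr (le_trans (ler_norm _))// normrM normrN (gtr0_norm a0).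
  by rewrite ler_wpM2l.
have h4 : c * (e / (2 * c)) = e / 2 by field; rewrite gt_eqF.
have h5 : 0 <= e / (2 * c) by rewrite ltW// divr_gt0// mulr_gt0.
by move: h1 h2 h3 h4 h5; rewrite /c; lra.
Unshelve. all: by end_near. Qed.

End curves.

(** * Subgradients as exact affine minorants *)

Lemma line_comb {R : realType} {V : lmodType R} (w p : V) (t x y : R) :
  t *: (w + x *: p) + (1 - t) *: (w + y *: p) = w + (t * x + (1 - t) * y) *: p.
Proof.
by rewrite !scalerDr addrACA -scalerDl [t + _]addrC subrK scale1r !scalerA -scalerDl.
Qed.

Lemma line_sub {R : realType} {V : lmodType R} (a b p : V) (s k : R) :
  (a + s *: p) - (b + k *: p) = (a - b) + (s - k) *: p.
Proof. by rewrite opprD addrACA -scalerBl. Qed.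

Lemma segment_path {R : realType} {V : lmodType R} (x y : V) :
  exists w, exists z : R -> V,
    [/\ z 0 = x, z 1 = y & forall s t, z t - z s = (t - s) *: w].
Proof.
exists (y - x), (fun s => x + s *: (y - x)); split.
- by rewrite scale0r addr0.
- by rewrite scale1r addrC subrK.
- by move=> s t; rewrite line_sub subrr add0r.
Qed.

Section ereal_functionals.
Context {R : realType}.

Lemma edomain_fin {V : Type} (phi : V -> \bar R) (v : V) :
  (forall w, -oo < phi w)%E -> edomain phi v -> exists r : R, phi v = r%:E.
Proof.
move=> phiNy; rewrite /edomain /=; have := phiNy v.
by case: (phi v) => [r| |]//; exists r.
Qed.

Lemma ereal_dense (c : R) (x : \bar R) : (c%:E < x)%E ->
  exists2 r : R, c < r & (r%:E < x)%E.
Proof.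
case: x => [x| |]//.
  by rewrite lte_fin => cx; exists ((c + x) / 2); rewrite ?lte_fin; have := midf_lt cx; lra.
by move=> _; exists (c + 1); [rewrite ltrDl|rewrite ltry].
Qed.

Lemma ge0_affine_limit (A B : R) : (forall t, 0 < t < 1 -> 0 <= A + t * B) -> 0 <= A.
Proof.
move=> AB; apply/ler_addgt0Pr => e e0.
pose t := Num.min (1 / 2) (e / (`|B| + 1)).
have B1 : 0 < `|B| + 1 by rewrite ltr_wpDl.
have t0 : 0 < t by rewrite lt_min !divr_gt0.
have t1 : t < 1 by rewrite gt_min; apply/orP; left; lra.
have te : t * (`|B| + 1) <= e by rewrite -ler_pdivlMr// ge_min lexx orbT.
have tB : t * B <= t * `|B| by rewrite ler_wpM2l ?ler_norm// ltW.
by have := AB t; rewrite t0 t1 => /(_ isT); lra.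
Qed.

Lemma lty_add_inv (x y : \bar R) : (-oo < x)%E -> (-oo < y)%E -> (x + y < +oo)%E ->
  (x < +oo)%E /\ (y < +oo)%E.
Proof. by case: x => [x| |]//; case: y => [y| |]// _ _; rewrite !ltry. Qed.

Lemma lte_add_split (r : R) (x y : \bar R) : (-oo < x)%E -> (-oo < y)%E ->
  (r%:E < x + y)%E -> exists c1 c2 : R, [/\ r < c1 + c2, (c1%:E < x)%E & (c2%:E < y)%E].
Proof.
case: x => [x| |]//; case: y => [y| |]// _ _.
- rewrite -EFinD lte_fin => rxy; exists (x - (x + y - r) / 3), (y - (x + y - r) / 3).
  by rewrite !lte_fin; split; lra.
- by move=> _; exists (x - 1), (r - x + 2); rewrite lte_fin ltry; split=> //; lra.
- by move=> _; exists (r - y + 2), (y - 1); rewrite lte_fin ltry; split=> //; lra.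
- by move=> _; exists (r + 1), 0; rewrite !ltry; split=> //; lra.
Qed.

End ereal_functionals.

Section subgradients.
Context {d : measure_display} {T : measurableType d} {R : realType}.
Context {mu : {measure set T -> \bar R}}.
Local Notation H := (LspaceType2 mu).

(** The global form of the j-subgradient: y is the slope of an affine function of
    j that lies below phi and meets it at v. *)
Definition supports {V : lmodType R} (phi : V -> \bar R) (j : V -> H) (v : V) (y : H) :
  Prop :=
  edomain phi v /\ forall w, (phi v + (L2_inner y (j w - j v))%:E <= phi w)%E.

(** The difference quotients of a convex functional are nondecreasing in t, so the
    liminf at 0 is below the quotient at t = 1; conversely an affine minorant
    bounds all the quotients. *)
Lemma j_subgradientP {V : lmodType R} (phi : V -> \bar R) (j : {linear V -> H}) (u f : H) :
  (forall w, -oo < phi w)%E -> econvex phi ->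
  j_subgradient phi j (u, f) <-> exists2 v, j v = u & supports phi j v f.
Proof.
move=> phiNy phicvx; split=> [[v [Dv jv sub]]|[v jv [Dv sub]]]; exists v => //; last first.
  split=> // w; rewrite limf_einfE /=.
  apply: ereal_sup_ge; exists (ereal_inf [set ((phi (v + t *: w)%R -
    phi v) * (t^-1)%:E)%E | t in [set t : R | 0 < t]]).
    by exists [set t : R | 0 < t] => //; exact: nbhs_right_gt.
  apply: le_ereal_inf_tmp => _ [t /= t0 <-].
  have [r phiv] := edomain_fin phiNy Dv.
  have jE : j (v + t *: w) - j v = t *: j w by rewrite linearD linearZ/= addrC addKr.
  have := sub (v + t *: w); rewrite phiv jE L2_innerZr.
  have := phiNy (v + t *: w).
  case: (phi (v + t *: w)) => [s| |]// _.
    rewrite -EFinD -EFinB -EFinM !lee_fin => h.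
    rewrite ler_pdivlMr//; lra.
  by move=> _; rewrite addye// gt0_mulye ?lte_fin ?invr_gt0// leey.
split=> // w; rewrite leNgt; apply/negP => lt_w.
have [r phiv] := edomain_fin phiNy Dv.
have Dw : edomain phi w by apply: lt_trans lt_w _; rewrite phiv -EFinD ltry.
have [s phiw] := edomain_fin phiNy Dw.
move: lt_w; rewrite phiv phiw -EFinD lte_fin => lt_w.
have := sub (w - v); rewrite leNgt => /negP; apply.
apply: (@le_lt_trans _ _ (s - r)%:E); last by rewrite linearB lte_fin; lra.
rewrite limf_einfE; apply: ge_ereal_sup => _ [U U0 <-].
have [t [Ut t0 t1]] : exists t : R, [/\ U t, 0 < t & t < 1].
  near (0 : R)^'+ => t; exists t; split; near: t => //;
    [exact: nbhs_right_gt|exact: nbhs_right_lt].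
apply: ereal_inf_le; exists ((phi (v + t *: (w - v))%R - phi v) * (t^-1)%:E)%E;
  first by exists t.
have := phicvx w v t; rewrite t0 t1 => /(_ isT).
have -> : t *: w + (1 - t) *: v = v + t *: (w - v).
  by rewrite scalerBl scale1r scalerBr addrCA addrC -addrA addrC.
rewrite phiv phiw -!EFinM -EFinD.
have := phiNy (v + t *: (w - v)).
case: (phi (v + t *: (w - v))) => [q| |]// _; rewrite !lee_fin => h.
rewrite ler_pdivrMr//; lra.
Unshelve. all: by end_near. Qed.

End subgradients.

(** * The resolvent and the functional induced on L^2 *)

Section resolvent.
Context {d : measure_display} {T : measurableType d} {R : realType}.
Context {mu : {measure set T -> \bar R}}.
Local Notation H := (LspaceType2 mu).
Context {V : tvsType R} (j : {linear V -> H}).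
Hypothesis j_weak : continuous (j : weak V -> weak H).
Variable phi : V -> \bar R.
Hypothesis phiNy : forall v, (-oo < phi v)%E.
Hypothesis phi_convex : econvex phi.
Hypothesis phi_proper : edomain phi !=set0.
Hypothesis phi_lsc : lower_semicontinuous phi.

Lemma sublevel_weakly_closed (c : R) :
  closed ([set v | (phi v <= c%:E)%E] : set (weak V)).
Proof.
apply: closed_convex_weakly_closed.
  exact: (lower_semicontinuous_sublevel phi).1.
move=> x y t /= xc yc /andP[t0 t1]; apply: le_trans (phi_convex _ _ _) _;
  first by rewrite t0.
have -> : c%:E = (t%:E * c%:E + (1 - t)%:E * c%:E)%E.
  by rewrite -!EFinM -EFinD; congr EFin; ring.
by apply: leeD; apply: lee_wpmul2l => //; rewrite lee_fin ?subr_ge0 ltW.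
Qed.

(** Inner products with k are elements of the dual of H, and j is continuous for
    the weak topologies. *)
Lemma weak_inner_continuous (k : H) : continuous ((fun v => L2_inner k (j v)) : weak V
  -> R^o).
Proof.
move=> v; pose f : tvs_dual H := exist _ (L2_inner k : {linear H -> R^o})
  (@L2_inner_continuous _ _ _ _ k).
apply: (@continuous_comp (weak V) (weak H) R^o j (sval f)); first exact: j_weak.
exact: weak_continuous.
Qed.

Lemma penalized_weakly_closed (kappa : R) (u : H) (c : R) : 0 <= kappa ->
  closed ([set v | (phi v + (kappa / 2 * `|j v - u| ^+ 2)%:E <= c%:E)%E] : set (weak V)).
Proof.
move=> k0; rewrite -openC openE => v0 /= /negP; rewrite -ltNge => cv0.
(* The squared norm is the supremum of the affine functionals
   x |-> 2 <k, x> - |k|^2; the one with k = j v0 - u is exact at v0. *)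
pose k := j v0 - u.
pose l v := kappa / 2 * (2 * L2_inner k (j v) - 2 * L2_inner k u - `|k| ^+ 2).
have lle v : l v <= kappa / 2 * `|j v - u| ^+ 2.
  rewrite /l ler_wpM2l ?divr_ge0//.
  have := sqr_ge0 (Num.norm ((j v - u) - k)); rewrite L2_normB.
  by rewrite L2_innerC L2_innerBr; lra.
have l0 : l v0 = kappa / 2 * `|j v0 - u| ^+ 2.
  rewrite /l -mulrBr -L2_innerBr -/k L2_inner_norm; congr (_ * _); ring.
have [r cr rphi] : exists2 r : R, c - l v0 < r & (r%:E < phi v0)%E.
  apply: ereal_dense; move: cv0; rewrite -l0; have := phiNy v0.
  case: (phi v0) => [q _|_ _|//]; last by rewrite ltry.
  by rewrite -EFinD !lte_fin; lra.
have ip_cvg : (fun v : weak V => L2_inner k (j v) : R) @ (v0 : weak V) --> (L2_inner k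
  (j v0) : R).
  exact: weak_inner_continuous.
have lcont : (fun v : weak V => l v) @ (v0 : weak V) --> l v0.
  have FF : Filter (nbhs (v0 : weak V)) := nbhs_filter (v0 : weak V).
  have /(_ FF FF) c1 := cvgM (cvg_cst (2 : R)) ip_cvg.
  have /(_ FF FF) c2 := cvgB c1 (cvg_cst (2 * L2_inner k u)).
  have /(_ FF FF) c3 := cvgB c2 (cvg_cst (`|k| ^+ 2)).
  have /(_ FF FF) c4 := cvgM (cvg_cst (kappa / 2)) c3.
  exact: c4.
have n1 : nbhs (v0 : weak V) [set v : weak V | (r%:E < phi v)%E].
  apply: open_nbhs_nbhs; split => //.
  have := @sublevel_weakly_closed r; rewrite -openC; congr open.
  by apply/seteqP; split=> v /=; rewrite ltNge => /negP.
have n2 : nbhs (v0 : weak V) [set v : weak V | c - r < l v].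
  apply: (lcont [set z : R | c - r < z]); apply: lt_nbhsr; lra.
apply: filterS2 n1 n2 => v /= rv lv; apply/negP; rewrite -ltNge.
have := lle v; move: rv; have := phiNy v.
case: (phi v) => [q _|_ _ _|//]; last by rewrite addye// ltry.
by rewrite -EFinD !lte_fin; lra.
Qed.

Variable omega : R.
Hypothesis omega0 : 0 <= omega.
Hypothesis phi_coercive : coercive (fun v => (phi v + (omega / 2 * `|j v| ^+ 2)%:E)%E).

(** Coercivity in the form in which it is used: filters take the place of nets,
    and cluster points are seen through weakly closed sets only, the weak
    topology being possibly non-Hausdorff. *)
Lemma weak_cluster_point (F : set_system V) (c : R) : ProperFilter F ->
  F [set v | (phi v + (omega / 2 * `|j v| ^+ 2)%:E <= c%:E)%E] ->
  exists p : V, forall A : set V, closed (A : set (weak V)) -> F A -> A p.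
Proof.
move=> FF Fc; have [U cU [Ucpt _]] := phi_coercive c.
have FU : F U by apply: filterS Fc => v; exact: cU.
have [p [_ Fp]] := Ucpt F FF FU.
exists p => A Aclosed FA; apply: Aclosed => B pB; exact: Fp.
Qed.

Lemma coercive_penalized (kappa : R) (u x : H) : omega < kappa ->
  omega / 2 * `|x| ^+ 2 <=
  kappa / 2 * `|x - u| ^+ 2 + kappa ^+ 2 / (2 * (kappa - omega)) * `|u| ^+ 2.
Proof.
move=> ok; have ko : 0 < kappa - omega by rewrite subr_gt0.
(* Completing the square in kappa / 2 * |x - u|^2 - omega / 2 * |x|^2. *)
have := sqr_ge0 (Num.norm (x - (kappa / (kappa - omega)) *: u)).
rewrite !L2_normB L2_innerZr normrZ exprMn real_normK ?num_real//.
set n := `|x| ^+ 2; set q := L2_inner x u => h.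
have h2 : 0 <= (kappa - omega) / 2 * (n - 2 * (kappa / (kappa -
  omega) * q) + (kappa / (kappa - omega)) ^+ 2 * `|u| ^+ 2).
  by rewrite mulr_ge0// divr_ge0// ltW.
have E : (kappa - omega) / 2 * (n - 2 * (kappa / (kappa -
  omega) * q) + (kappa / (kappa - omega)) ^+ 2 * `|u| ^+ 2)
  = (kappa - omega) / 2 * n - kappa * q + kappa ^+ 2 / (2 * (kappa - omega)) * `|u| ^+ 2.
  by field; rewrite gt_eqF.
have k0 : 0 <= kappa / 2 * `|u| ^+ 2.
  by rewrite mulr_ge0 ?sqr_ge0// divr_ge0// ltW// (le_lt_trans omega0).
by move: h2; rewrite E; lra.
Qed.

Lemma resolvent_minimizer (kappa : R) (u : H) : omega < kappa ->
  exists p : V, edomain phi p /\ forall v,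
    (phi p + (kappa / 2 * `|j p - u| ^+ 2)%:E <=
      phi v + (kappa / 2 * `|j v - u| ^+ 2)%:E)%E.
Proof.
move=> ok; have k0 : 0 <= kappa by rewrite ltW// (le_lt_trans omega0).
pose Q v := (phi v + (kappa / 2 * `|j v - u| ^+ 2)%:E)%E.
(* A weak cluster point of the filter of nonempty sublevels of Q lies in all
   of them, hence minimizes Q. *)
pose B : set R := [set c | exists v, (Q v <= c%:E)%E].
pose F : set_system V := filter_from B (fun c => [set v | (Q v <= c%:E)%E]).
have Qfin v : edomain phi v -> exists c : R, Q v = c%:E.
  move=> /(edomain_fin phiNy)[r phiv]; exists (r + kappa / 2 * `|j v - u| ^+ 2).
  by rewrite /Q phiv.
have [v0 Dv0] := phi_proper; have [c0 Qv0] := Qfin v0 Dv0.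
have FF : ProperFilter F.
  apply: filter_from_proper; last by move=> c [v Qv]; exists v.
  apply: filter_from_filter; first by exists c0; exists v0; rewrite Qv0.
  move=> c1 c2 B1 B2; exists (Num.min c1 c2).
    by rewrite /Num.min; case: ifP.
  by move=> v /= Qv; split; apply: le_trans Qv _; rewrite lee_fin ge_min lexx ?orbT.
have [|p pF] := @weak_cluster_point F (c0 + kappa ^+ 2 / (2 * (kappa -
  omega)) * `|u| ^+ 2) FF.
  exists c0; first by exists v0; rewrite Qv0.
  move=> v /=; rewrite /Q; have := coercive_penalized u (j v) ok; have := phiNy v.
  by case: (phi v) => [q| |]//= _; rewrite -!EFinD !lee_fin; lra.
have Qp v c : Q v = c%:E -> (Q p <= c%:E)%E.
  move=> Qv; apply: (pF [set w | (Q w <= c%:E)%E]); first exact: penalized_weakly_closed.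
  by exists c => //; exists v; rewrite Qv.
have Dp : edomain phi p.
  have := Qp _ _ Qv0; rewrite /Q /edomain /=.
  by case: (phi p) => [q| |]//=; rewrite ltry.
exists p; split=> // v; have [Dv|Dv] := pselect (edomain phi v).
  by have [c Qv] := Qfin v Dv; rewrite -/(Q p) -/(Q v) Qv (Qp v).
have -> : phi v = +oo%E.
  by apply/eqP; rewrite -leye_eq leNgt; apply/negP.
by rewrite addye// leey.
Qed.

(** The first-order condition for the minimizer: move from p towards w by t, use
    convexity of phi, divide by t and let t tend to 0. *)
Lemma resolvent_supports (kappa : R) (u : H) : omega < kappa ->
  exists p : V, supports phi j p (kappa *: (u - j p)) /\ forall v,
    (phi p + (kappa / 2 * `|j p - u| ^+ 2)%:E <=
      phi v + (kappa / 2 * `|j v - u| ^+ 2)%:E)%E.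
Proof.
move=> ok; have [p [Dp pmin]] := resolvent_minimizer u ok; exists p; split=> //.
split=> // w; have [r phip] := edomain_fin phiNy Dp.
have [Dw|Dw] := pselect (edomain phi w); last first.
  have -> : phi w = +oo%E.
    by apply/eqP; rewrite -leye_eq leNgt; apply/negP.
  by rewrite leey.
have [s phiw] := edomain_fin phiNy Dw.
rewrite phip phiw -EFinD lee_fin L2_innerZl -subr_ge0.
apply: (@ge0_affine_limit _ _ (kappa / 2 * `|j w - j p| ^+ 2)) => t /andP[t0 t1].
have := pmin (t *: w + (1 - t) *: p).
have := phi_convex w p (t := t); rewrite t0 t1 => /(_ isT).
have -> : j (t *: w + (1 - t) *: p) - u = (j p - u) + t *: (j w - j p).
  by rewrite linearD !linearZ/= scalerBl scale1r scalerBr addrCA addrAC.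
rewrite phip phiw -!EFinM -!EFinD (L2_normD (j p -
  u)) L2_innerZr normrZ exprMn real_normK ?num_real//.
have -> : L2_inner (u - j p) (j w - j p) = - L2_inner (j p - u) (j w - j p).
  by rewrite -L2_innerNl opprB.
set q := L2_inner _ _; set n := `|j w - j p| ^+ 2.
case: (phi _) => [z| |]//; rewrite -?EFinD !lee_fin => h1 h2.
rewrite -(pmulr_rge0 _ t0).
have k0 : 0 <= kappa by rewrite ltW// (le_lt_trans omega0).
move: h1 h2; lra.
Qed.

Variable psi : H -> \bar R.
Hypothesis psiP : H_functional phi j psi.

Lemma supports_H_functional v y : supports phi j v y -> supports psi idfun (j v) y.
Proof.
case: psiP => psiNy psi_convex _ _ sub vy.
have /sub : j_subgradient phi j (j v, y) by apply/j_subgradientP => //; exists v.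
by move=> /(j_subgradientP _ _ _ psiNy psi_convex)[w /= ->].
Qed.

Lemma supports_fine_le {W : lmodType R} (chi : W -> \bar R) (i : W -> H) v w y :
  (forall v, -oo < chi v)%E -> supports chi i v y -> edomain chi w ->
  fine (chi v) + L2_inner y (i w - i v) <= fine (chi w).
Proof.
move=> chiNy [Dv sup] Dw.
have [r chiv] := edomain_fin chiNy Dv; have [s chiw] := edomain_fin chiNy Dw.
by have := sup w; rewrite chiv chiw -EFinD lee_fin.
Qed.

(** The difference between the functional on H, seen on V through j, and phi. *)
Let gap v := fine (psi (j v)) - fine (phi v).

(** Both phi and psi o j have the slopes kappa * (z s - j (p s)) along the path of
    minimizers p s for z s.  Comparing the two subgradient inequalities leaves
    <y t - y s, j (p t) - j (p s)>, which is at most kappa / 2 * |z t - z s|^2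
    because z = j p + y / kappa. *)
Lemma gap_le v0 y0 v1 y1 : supports phi j v0 y0 -> supports phi j v1 y1 ->
  gap v1 <= gap v0.
Proof.
move=> s0 s1; have [psiNy psi_convex _ _ _] := psiP.
pose kappa := omega + 1; have ok : omega < kappa by rewrite ltrDl.
have k0 : 0 < kappa by apply: le_lt_trans ok.
have [w [z [z0E z1E zB]]] := segment_path (j v0 + kappa^-1 *: y0) (j v1 + kappa^-1 *: y1).
(* z runs along the segment between the points that v0 and v1 resolve. *)
have path s : exists v, supports phi j v (kappa *: (z s - j v)) /\
    (s = 0 -> v = v0) /\ (s = 1 -> v = v1).
  have [->|sn0] := eqVneq s 0.
    exists v0; split; last by split=> // /esym/eqP; rewrite oner_eq0.
    by rewrite z0E addrC addKr scalerA divff ?scale1r// gt_eqF.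
  have [->|sn1] := eqVneq s 1.
    exists v1; split; last by split=> // /eqP; rewrite oner_eq0.
    rewrite z1E addrC addKr.
    by rewrite scalerA divff ?scale1r// gt_eqF.
  have [v [sv _]] := resolvent_supports (z s) ok.
  by exists v; split=> //; split=> /eqP; rewrite ?(negbTE sn0) ?(negbTE sn1).
have /choice[p pP] := path.
have p0 : p 0 = v0 by have [_ [+ _]] := pP 0; apply.
have p1 : p 1 = v1 by have [_ [_ +]] := pP 1; apply.
pose C := kappa / 2 * `|w| ^+ 2.
have C0 : 0 <= C by rewrite mulr_ge0 ?sqr_ge0// divr_ge0// ltW.
have step s t : 0 <= s -> s <= t -> t <= 1 -> gap (p t) - gap (p s) <=
  0 * (t - s) + C * (t - s) ^+ 2.
  move=> _ _ _; rewrite mul0r add0r.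
  have [ss _] := pP s; have [st _] := pP t.
  set ys := kappa *: (z s - j (p s)) in ss.
  set yt := kappa *: (z t - j (p t)) in st.
  have ss' := supports_H_functional ss; have st' := supports_H_functional st.
  have h1 := supports_fine_le psiNy st' ss'.1.
  have h2 := supports_fine_le phiNy ss st.1.
  have h3 : L2_inner (yt - ys) (j (p t) - j (p s)) <= C * (t - s) ^+ 2.
    have E : (t - s) *: w = (j (p t) - j (p s)) + kappa^-1 *: (yt - ys).
      rewrite /yt /ys -scalerBr scalerA mulVf ?gt_eqF// scale1r.
      rewrite -zB.
      move: (z t) (z s) (j (p t)) (j (p s)) => a b c e.
      by rewrite opprB addrA [c - e + _]addrC !addrA !subrK.
    have := congr1 (fun x : H => `|x| ^+ 2) E.
    rewrite normrZ exprMn real_normK ?num_real// (L2_normD (j (p t) - j (p s))) L2_innerZr.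
    rewrite [L2_inner (j (p t) - _) _]L2_innerC => E2.
    have g1 := sqr_ge0 (Num.norm (j (p t) - j (p s))).
    have g2 := sqr_ge0 (Num.norm (kappa^-1 *: (yt - ys))).
    have g3 : 2 * (kappa^-1 * L2_inner (yt - ys) (j (p t) - j (p s))) <=
      (t - s) ^+ 2 * `|w| ^+ 2.
      by rewrite E2; lra.
    apply: (@le_trans _ _ (kappa * (2^-1 * ((t - s) ^+ 2 * `|w| ^+ 2)))).
      by rewrite -ler_pdivrMl//; lra.
    by rewrite /C; lra.
  rewrite /gap.
  move: h1 h2 h3; rewrite /= L2_innerBl.
  have -> : j (p s) - j (p t) = - (j (p t) - j (p s)) by rewrite opprB.
  by rewrite L2_innerNr; lra.
have := increment_quadratic ler01 C0 step.
by rewrite p0 p1 mul0r subr_le0.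
Qed.

(** A penalty that grows like eps^-2 forces distance less than eps, as long as the
    cost of leaving is at most affine in the distance. *)
Lemma penalty_small (A m delta eps : R) : 0 < eps -> 0 <= delta ->
  (2 + omega + 2 * `|A + m ^+ 2 / 2| / eps ^+ 2) / 2 * delta ^+ 2 <= A + m * delta ->
  delta < eps.
Proof.
move=> e0 d0 h; rewrite ltNge; apply/negP => ed.
set B := A + m ^+ 2 / 2 in h *.
(* 2 * m * delta <= m^2 + delta^2 *)
have h1 : A + m * delta <= B + delta ^+ 2 / 2.
  by have := sqr_ge0 (m - delta); rewrite /B; lra.
have BB : B <= `|B| := ler_norm B.
have de : eps ^+ 2 <= delta ^+ 2 by rewrite ler_pXn2r// nnegrE// ltW.
have e20 : 0 < eps ^+ 2 by rewrite exprn_gt0.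
have h2 : 2 * `|B| <= 2 * `|B| / eps ^+ 2 * delta ^+ 2.
  by rewrite mulrAC ler_pdivlMr// ler_wpM2l// mulr_ge0.
have h3 : 0 <= omega * delta ^+ 2 by rewrite mulr_ge0 ?sqr_ge0.
by move: h h1 h2 h3 de e20 BB; lra.
Qed.

(** By [gap_le] the identity psi (j v) = phi v + c holds at every v with an exact
    affine minorant.  The minimizers of phi + kappa / 2 * |j - u|^2 are such
    points and their images tend to u.  They satisfy phi p <= phi v when u = j v,
    so lower semicontinuity of psi gives the upper bound; they satisfy
    psi (j p) <= psi u, so a weak cluster point attains u at no greater cost. *)
Lemma H_functional_infimum : exists c : R,
  (forall v, edomain phi v -> (psi (j v) <= phi v + c%:E)%E) /\
  (forall u, edomain psi u -> exists v,
    [/\ edomain phi v, j v = u & (phi v + c%:E <= psi u)%E]).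
Proof.
have [psiNy psi_convex _ psi_lsc _] := psiP.
have resolve kappa u := @resolvent_supports kappa u.
have ok1 : omega < omega + 1 by rewrite ltrDl.
have [vs [svs _]] := resolve _ 0 ok1; set ys := _ *: _ in svs.
(* (vs, ys) also provides the affine minorants that keep minimizers close. *)
pose c := gap vs; exists c.
have gapE v y : supports phi j v y -> fine (psi (j v)) = fine (phi v) + c.
  move=> sv; have : gap v = c.
    by apply/eqP; rewrite eq_le (gap_le svs sv) (gap_le sv svs).
  by rewrite /gap => <-; rewrite addrC subrK.
have kappa_gt A eps : omega < 2 + omega + 2 * `|A : R| / eps ^+ 2.
  have : 0 <= 2 * `|A| / eps ^+ 2 by rewrite divr_ge0 ?sqr_ge0// mulr_ge0.
  by lra.
split.
- move=> v Dv; rewrite leNgt; apply/negP => lt_psi.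
  have [r phiv] := edomain_fin phiNy Dv.
  have [U Uv Ugt] := psi_lsc (j v) (r + c) ltac:(by rewrite EFinD -phiv).
  have /nbhs_ballP[eps /= eps0 epsU] := Uv.
  pose A := fine (phi v) - fine (phi vs) - L2_inner ys (j v - j vs).
  have AE : A = fine (phi v) - fine (phi vs) - L2_inner ys (j v - j vs) by [].
  pose m := `|ys|.
  pose kappa := 2 + omega + 2 * `|A + m ^+ 2 / 2| / eps ^+ 2.
  have ok : omega < kappa by exact: kappa_gt.
  have [p [sp pmin]] := resolve kappa (j v) ok.
  have [q phip] := edomain_fin phiNy sp.1.
  have small : `|j p - j v| < eps.
    apply: (@penalty_small A m) => //; rewrite -/kappa.
    have := pmin v; rewrite subrr normr0 expr0n/= mulr0 adde0 phip phiv -EFinD lee_fin.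
    have := supports_fine_le phiNy svs sp.1; rewrite phip /=.
    have -> : j p - j vs = (j p - j v) + (j v - j vs) by rewrite addrA subrK.
    rewrite L2_innerDr.
    have := L2_norm_inner ys (j p - j v); rewrite ler_norml => /andP[+ _].
    by move: AE; rewrite phiv /= /m; lra.
  have pU : U (j p) by apply: epsU; rewrite -ball_normE /= distrC.
  have := Ugt _ pU; have [z psip] := edomain_fin psiNy (supports_H_functional sp).1.
  rewrite psip lte_fin ltNge => /negP; apply.
  have := gapE _ _ sp; rewrite psip phip /= => ->; rewrite lerD2r.
  have := pmin v; rewrite subrr normr0 expr0n/= mulr0 adde0 phip phiv -EFinD lee_fin.
  apply: le_trans; rewrite lerDl mulr_ge0 ?sqr_ge0// divr_ge0//.
  by rewrite ltW// (le_lt_trans omega0).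
- move=> u Du; have [z psiu] := edomain_fin psiNy Du.
  have approx eps : 0 < eps -> exists p, [/\ `|j p - u| < eps & (phi p <= (z - c)%:E)%E].
    move=> eps0.
    pose A := z - fine (psi (j vs)) - L2_inner ys (u - j vs).
    have AE : A = z - fine (psi (j vs)) - L2_inner ys (u - j vs) by [].
    pose m := `|ys|.
    pose kappa := 2 + omega + 2 * `|A + m ^+ 2 / 2| / eps ^+ 2.
    have ok : omega < kappa by exact: kappa_gt.
    have [p [sp pmin]] := resolve kappa u ok.
    have k0 : 0 <= kappa by rewrite ltW// (le_lt_trans omega0).
    have spH := supports_H_functional sp.
    have h1 := supports_fine_le psiNy spH Du.
    have h2 := supports_fine_le psiNy (supports_H_functional svs) spH.1.
    rewrite /= psiu /= L2_innerZl L2_inner_norm in h1.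
    exists p; split.
      apply: (@penalty_small A m) => //; rewrite -/kappa distrC.
      have := L2_norm_inner ys (j p - u); rewrite ler_norml => /andP[+ _].
      rewrite /= in h2; move: h2.
      have -> : j p - j vs = (j p - u) + (u - j vs) by rewrite addrA subrK.
      rewrite L2_innerDr (distrC (j p) u) => h2 h3.
      have h4 : 0 <= kappa / 2 * `|u - j p| ^+ 2.
        by rewrite mulr_ge0 ?sqr_ge0// divr_ge0.
      by move: h1 h2 h3 h4 AE; rewrite /m; lra.
    have [q phip] := edomain_fin phiNy sp.1.
    have := gapE _ _ sp; rewrite phip /= lee_fin => E.
    have h5 : 0 <= kappa * `|u - j p| ^+ 2 by rewrite mulr_ge0 ?sqr_ge0.
    by move: h1; rewrite E; lra.
  (* Cluster points of this filter lie in the fiber of u, because each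
     <k, j v> is weakly continuous. *)
  pose F : set_system V := filter_from [set eps : R | 0 < eps]
    (fun eps => [set v | `|j v - u| < eps /\ (phi v <= (z - c)%:E)%E]).
  have FF : ProperFilter F.
    apply: filter_from_proper; last by move=> eps /approx[p pP]; exists p.
    apply: filter_from_filter; first by exists 1; exact: ltr01.
    move=> e1 e2 /= e10 e20; exists (Num.min e1 e2); first by rewrite /= lt_min e10.
    by move=> v /= [+ phiv]; rewrite lt_min => /andP[].
  have [|p pF] := weak_cluster_point (c := z - c + omega / 2 * (`|u| + 1) ^+ 2) FF.
    exists 1; first exact: ltr01.
    move=> v /= [vu phiv]; rewrite (EFinD (z - c)); apply: leeD => //; rewrite lee_fin.
    rewrite ler_wpM2l ?divr_ge0// ler_pXn2r ?nnegrE ?addr_ge0//.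
    by rewrite -[j v](subrK u) addrC (le_trans (ler_normD _ _))// lerD2l ltW.
  have phip : (phi p <= (z - c)%:E)%E.
    apply: (pF [set v | (phi v <= (z - c)%:E)%E]); first exact: sublevel_weakly_closed.
    by exists 1; [exact: ltr01|move=> v []].
  exists p; split.
  + by apply: le_lt_trans phip _; rewrite ltry.
  + apply/eqP; rewrite -subr_eq0 -normr_eq0 eq_le normr_ge0 andbT.
    apply/ler_addgt0Pr => eps eps0; rewrite add0r.
    pose k := j p - u.
    have [k0|k0] := eqVneq `|k| 0; first by rewrite -/k k0 ltW.
    have kgt0 : 0 < `|k| by rewrite lt_neqAle eq_sym k0 normr_ge0.
    suff : L2_inner k (j p) <= `|k| * eps + L2_inner k u.
      by rewrite -lerBlDr -L2_innerBr L2_inner_norm expr2 ler_pM2l.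
    apply: (pF [set v | L2_inner k (j v) <= `|k| * eps + L2_inner k u]).
      apply: (@closed_comp (weak V) R^o (fun v => L2_inner k (j v))
        [set x : R^o | x <= `|k| * eps + L2_inner k u]).
        by move=> v _; exact: weak_inner_continuous.
      exact: closed_le.
    exists eps => // v [/= vu _].
    rewrite -lerBlDr -L2_innerBr (le_trans (L2_cauchy_schwarz _ _))//.
    by rewrite ler_wpM2l// ltW.
  + have := phiNy p; move: phip; case: (phi p) => [q| |]// + _.
    by rewrite psiu -EFinD !lee_fin; lra.
Qed.

End resolvent.

(** * Order-preserving semigroups and submodular functionals *)

Section flows.
Context {d : measure_display} {T : measurableType d} {R : realType}.
Context {mu : {measure set T -> \bar R}}.
Local Notation H := (LspaceType2 mu).
Local Notation leb := (@lebesgue_measure R).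
Context {V : lmodType R} (phi : V -> \bar R) (j : V -> H).
Variable psi : H -> \bar R.
Hypothesis psiP : H_functional phi j psi.

Lemma gradient_flow_curve (u0 : H) (u : R -> H) : gradient_flow phi j u0 u ->
  exists2 du : R -> H, weak_curve u du &
    {ae leb, forall t, 0 < t -> supports psi idfun (u t) (- du t)}.
Proof.
move=> [uc _ [du [_ [_ duM] uwd] usub]]; exists du.
  by split=> // h; exact: weak_derivative_inner.
case: psiP => psiNy psi_convex _ _ sub.
apply: filterS usub => t ut t0; have /sub := ut t0.
by move=> /(j_subgradientP _ _ _ psiNy psi_convex)[w /= ->].
Qed.

(** The evolution variational inequality, with the values of psi along the flow
    replaced by a lower bound c. *)
Lemma gradient_flow_evi (u0 x : H) (u : R -> H) (b c r : R) :
  gradient_flow phi j u0 u -> 0 < b -> psi x = r%:E ->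
  (forall t, 0 < t <= b -> (c%:E < psi (u t))%E) ->
  `|u b - x| ^+ 2 / 2 - `|u0 - x| ^+ 2 / 2 <= (r - c) * b.
Proof.
move=> uflow b0 psix cpsi; have [psiNy _ _ _ _] := psiP.
have [du udu usub] := gradient_flow_curve uflow.
have [_ <- _] := uflow.
apply: (weak_curve_energy0 (Phi := fun y => `|y - x| ^+ 2 / 2) (G := fun y => y -
  x) udu) => //.
- by move=> y z; exact: L2_sq_dist_energy.
- by move=> y z; rewrite opprB addrA subrK.
apply: filterS usub => t ut tb; have /andP[t0 _] := tb.
have Dx : edomain psi x by rewrite /edomain /= psix ltry.
have := supports_fine_le psiNy (ut t0) Dx; rewrite psix /=.
have [z psiz] := edomain_fin psiNy (ut t0).1.
have := cpsi t tb; rewrite psiz lte_fin /= L2_innerNl L2_innerBr L2_innerBl.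
by rewrite !(L2_innerC (du t)); lra.
Qed.

End flows.

(** Add the hypotheses for s = h, 2 h, ..., (N + 1) h with h = 1 / (N + 2); only the
    terms at both ends survive. *)
Lemma telescope_rearranged {R : realType} (f g : R -> R) (N : nat) :
  (forall s h, 0 < h -> h <= s -> s + h <= 1 -> f s + g s <= f (s + h) + g (s - h)) ->
  f (N.+2%:R^-1) + g (1 - N.+2%:R^-1) <= f 1 + g 0.
Proof.
move=> fg; set h : R := N.+2%:R^-1.
have h0 : 0 < h by rewrite invr_gt0.
have hN : h * N.+2%:R = 1 by rewrite mulVf.
have nS (k : nat) : k.+1%:R * h = k%:R * h + h by rewrite -natr1 mulrDl mul1r.
have step (m : nat) : (m < N.+1)%N -> f h + g (m.+1%:R * h) <= f (m.+2%:R * h) + g 0.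
  elim: m => [_|m IHm mN].
    have := fg h h h0 (lexx _); rewrite subrr mul1r mulr_natl; apply.
    have h2N : 2 <= N.+2%:R :> R by rewrite ler_nat.
    by have := ler_wpM2l (ltW h0) h2N; rewrite hN; lra.
  have := fg (m.+2%:R * h) h h0.
  have -> : m.+2%:R * h + h = m.+3%:R * h by rewrite [RHS]nS.
  have -> : m.+2%:R * h - h = m.+1%:R * h by rewrite [m.+2%:R * h]nS addrK.
  have h1 : h <= m.+2%:R * h by rewrite ler_peMl ?(ltW h0)// ler1n.
  have h2 : m.+3%:R * h <= 1 by rewrite -[leRHS]hN mulrC ler_pM2l// ler_nat.
  move=> /(_ h1 h2); have := IHm (ltnW mN); lra.
have := step N (ltnSn _); rewrite [_.+2%:R * h]mulrC hN.
by have -> : N.+1%:R * h = 1 - h by rewrite -[in RHS]hN [h * _]mulrC [in RHS]nS addrK.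
Qed.

Section order.
Context {d : measure_display} {T : measurableType d} {R : realType}.
Context {mu : {measure set T -> \bar R}}.
Local Notation H := (LspaceType2 mu).
Context {V : lmodType R} (phi : V -> \bar R) (j : V -> H).
Hypothesis j_dense : dense (j @` edomain phi).
Variable psi : H -> \bar R.
Hypothesis psiP : H_functional phi j psi.
Variable C : set H.
Hypothesis C_convex : convex_set C.
Hypothesis C_meet : forall u v, C u -> C v -> C (u `&` v)%O.
Hypothesis C_join : forall u v, C u -> C v -> C (u `|` v)%O.
Variable S : R -> H -> H.
Hypothesis S_gen : generated_semigroup phi j S.
Hypothesis S_inv : leaves_invariant S C.

Definition submodular_on :=
  forall u1 u2, C u1 -> C u2 ->
    (psi (u1 `&` u2)%O + psi (u1 `|` u2)%O <= psi u1 + psi u2)%E.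

(** Since j maps the domain onto a dense set, every point is an admissible initial
    value. *)
Lemma semigroup_flow u0 : gradient_flow phi j u0 (fun t => S t u0).
Proof.
apply: S_gen => B u0B.
have [|y [By Dy]] := j_dense _ (open_interior B).
  by exists u0.
by exists y; split=> //; exact: interior_subset.
Qed.

Lemma semigroup0 u0 : S 0 u0 = u0.
Proof. by have [_ ] := semigroup_flow u0. Qed.

(** The energy is half the squared norm of L2_pos (S t u - S t v).  Its dissipation
    is bounded by testing the subgradient at S t u with the meet and the
    subgradient at S t v with the join. *)
Lemma submodular_order_preserving : submodular_on -> order_preserving_on S C.
Proof.
move=> sm u v Cu Cv uv t t0; have [psiNy _ _ _ _] := psiP.
move: t0; rewrite le_eqVlt => /predU1P[<-|t0]; first by rewrite !semigroup0.
have [du udu usub] := gradient_flow_curve psiP (semigroup_flow u).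
have [dv vdv vsub] := gradient_flow_curve psiP (semigroup_flow v).
have wdw := weak_curveB udu vdv.
apply/L2_le_pos.
have : `|L2_pos (S t u - S t v)| ^+ 2 / 2 - `|L2_pos (S 0 u - S 0 v)| ^+ 2 / 2 <= 0 * t.
  apply: (weak_curve_energy0 (Phi := fun y => `|L2_pos y| ^+ 2 / 2) (G := @L2_pos _ _ _
    mu) wdw) => //.
  - by move=> x y; exact: L2_pos_energy.
  - by move=> x y; exact: L2_pos_nonexpansive.
  apply: filterS2 usub vsub => s us vs /andP[s0 _].
  have {}us := us s0; have {}vs := vs s0.
  have CSu : C (S s u) by apply: (S_inv (ltW s0)); exists u.
  have CSv : C (S s v) by apply: (S_inv (ltW s0)); exists v.
  have smS := sm _ _ CSu CSv.
  have [ru psiu] := edomain_fin psiNy us.1; have [rv psiv] := edomain_fin psiNy vs.1.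
  rewrite psiu psiv in smS.
  have [rm psim] : exists r : R, psi (S s u `&` S s v)%O = r%:E.
    apply: edomain_fin => //; rewrite /edomain /=; move: smS (psiNy (S s u `|` S s v)%O).
    by case: (psi (_ `|` _)%O) => [r| |]//; case: (psi (_ `&` _)%O) => [q| |]//;
      rewrite ltry.
  have [rj psij] : exists r : R, psi (S s u `|` S s v)%O = r%:E.
    apply: edomain_fin => //; rewrite /edomain /=; move: smS; rewrite psim.
    by case: (psi (_ `|` _)%O) => [r| |]//; rewrite ltry.
  move: smS; rewrite psim psij -!EFinD lee_fin => smS.
  have h1 := us.2 (S s u `&` S s v)%O; have h2 := vs.2 (S s u `|` S s v)%O.
  move: h1 h2; rewrite psiu psiv psim psij -!EFinD !lee_fin /=.
  have -> : (S s u `&` S s v)%O - S s u = - L2_pos (S s u - S s v).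
    by rewrite L2_meet_pos addrAC subrr add0r.
  have -> : (S s u `|` S s v)%O - S s v = L2_pos (S s u - S s v).
    by rewrite L2_join_pos addrAC subrr add0r.
  rewrite !L2_innerNl L2_innerNr opprK L2_innerBr !(L2_innerC (L2_pos _)); lra.
rewrite mul0r !semigroup0; have /L2_le_pos -> := uv.
rewrite normr0 expr0n/= mul0r subr0 => h.
by apply/eqP; rewrite -normr_eq0 -sqrf_eq0 eq_le sqr_ge0 andbT; lra.
Qed.

Lemma psi_lower_bound_near (x : H) (c : R) : (c%:E < psi x)%E ->
  exists2 e : R, 0 < e & forall y, `|y - x| < e -> (c%:E < psi y)%E.
Proof.
move=> cx; have [_ _ _ psi_lsc _] := psiP.
have [U /nbhs_ballP[e /= e0 eU] Uc] := psi_lsc x c cx.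
by exists e => // y yx; apply/Uc/eU; rewrite -ball_normE /= distrC.
Qed.

Lemma C_segment x y (t : R) : C x -> C y -> 0 <= t <= 1 -> C (t *: x + (1 - t) *: y).
Proof. exact: convex_set_combination. Qed.

Lemma psi_lower_bound_along_flow (x : H) (c : R) : (c%:E < psi x)%E ->
  exists2 e : R, 0 < e & forall t, 0 < t <= e -> (c%:E < psi (S t x))%E.
Proof.
move=> cx; have [e e0 eP] := psi_lower_bound_near cx.
have [du udu _] := gradient_flow_curve psiP (semigroup_flow x).
have := weak_curve_continuous0 udu; rewrite /= semigroup0 => /cvgrPdist_lt/(_ e e0).
move=> /nbhs_ballP[r /= r0 rP]; exists (r / 2); first by rewrite divr_gt0.
move=> t /andP[t0 tr]; apply: eP; rewrite distrC; apply: rP => //.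
rewrite /ball /= sub0r normrN gtr0_norm//; lra.
Qed.

(** Otherwise the flow started at the projection (z1, z2) of (x, y) on the ordered
    pairs would strictly approach (x, y) while remaining ordered. *)
Lemma order_preserving_midpoint : order_preserving_on S C -> forall x y, C x -> C y ->
  (psi (x - 2^-1 *: L2_pos (x - y))%R + psi (y + 2^-1 *: L2_pos (x - y))%R <=
    psi x + psi y)%E.
Proof.
move=> Sop x y Cx Cy; have [psiNy _ _ _ _] := psiP.
set p := L2_pos (x - y); set z1 := x - _; set z2 := y + _.
have half01 : 0 <= (2^-1 : R) <= 1 by lra.
have half : 1 - 2^-1 = 2^-1 :> R by lra.
have Cz1 : C z1.
  have := C_segment (C_meet Cx Cy) Cx half01; rewrite L2_meet_pos -/p half.
  by rewrite scalerBr addrAC -scalerDl (_ : 2^-1 + 2^-1 = 1 :> R) ?scale1r//; lra.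
have Cz2 : C z2.
  have := C_segment (C_join Cx Cy) Cy half01; rewrite L2_join_pos -/p half.
  by rewrite scalerDr addrAC -scalerDl (_ : 2^-1 + 2^-1 = 1 :> R) ?scale1r//; lra.
have z12 : (z1 <= z2)%O by exact: L2_midpoint_le.
have [|Dx] := eqVneq (psi x) +oo%E.
  by move=> ->; rewrite addye ?leey// gt_eqF.
have [|Dy] := eqVneq (psi y) +oo%E.
  by move=> ->; rewrite addey ?leey// gt_eqF.
have [rx psix] : exists r : R, psi x = r%:E.
  by move: (psiNy x) Dx; case: (psi x) => [r| |]//; exists r.
have [ry psiy] : exists r : R, psi y = r%:E.
  by move: (psiNy y) Dy; case: (psi y) => [r| |]//; exists r.
rewrite leNgt psix psiy -EFinD; apply/negP.
move=> /(lte_add_split (psiNy _) (psiNy _))[c1 [c2 [cr cz1 cz2]]].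
have [e1 e10 e1P] := psi_lower_bound_along_flow cz1.
have [e2 e20 e2P] := psi_lower_bound_along_flow cz2.
pose b := Num.min e1 e2; have b0 : 0 < b by rewrite lt_min e10.
have h1 : `|S b z1 - x| ^+ 2 / 2 - `|z1 - x| ^+ 2 / 2 <= (rx - c1) * b.
  apply: (gradient_flow_evi psiP (semigroup_flow z1)) => // t /andP[t0 tb].
  by apply: e1P; rewrite t0 (le_trans tb)// ge_min lexx.
have h2 : `|S b z2 - y| ^+ 2 / 2 - `|z2 - y| ^+ 2 / 2 <= (ry - c2) * b.
  apply: (gradient_flow_evi psiP (semigroup_flow z2)) => // t /andP[t0 tb].
  by apply: e2P; rewrite t0 (le_trans tb)// ge_min lexx orbT.
have h3 := L2_le_dist_pos x y (Sop _ _ Cz1 Cz2 z12 b (ltW b0)).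
(* The projection realizes the lower bound h3 on the distance. *)
have n1 : `|z1 - x| ^+ 2 = `|p| ^+ 2 / 4.
  rewrite /z1 addrAC subrr add0r normrN normrZ exprMn real_normK ?num_real//.
  by rewrite mulrC; congr (_ * _); field.
have n2 : `|z2 - y| ^+ 2 = `|p| ^+ 2 / 4.
  rewrite /z2 addrAC subrr add0r normrZ exprMn real_normK ?num_real//.
  by rewrite mulrC; congr (_ * _); field.
rewrite -/p n1 n2 in h1 h2 h3.
have h4 : (rx + ry - c1 - c2) * b < 0 by rewrite pmulr_llt0//; lra.
by move: h1 h2 h3 h4; lra.
Qed.

(** [order_preserving_midpoint] is applied along the two parallel segments X, from
    the meet to u1, and Y, from u2 to the join. *)
Lemma order_preserving_submodular : order_preserving_on S C -> submodular_on.
Proof.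
move=> Sop u1 u2 Cu1 Cu2; have [psiNy psi_convex _ _ _] := psiP.
have [a aE] : exists a, a = (u1 `&` u2)%O by eexists.
have [b bE] : exists b, b = (u1 `|` u2)%O by eexists.
have [p pE] : exists p, p = L2_pos (u1 - u2) by eexists.
have Ca : C a by rewrite aE; exact: C_meet.
have Cb : C b by rewrite bE; exact: C_join.
rewrite -aE -bE; rewrite L2_meet_pos -pE in aE; rewrite L2_join_pos -pE in bE.
have u1E : u1 = a + p by rewrite aE subrK.
(* (u1 - u2)^+ and (u2 - u1)^+ are disjoint, which is what makes the positive
   part of X (s + h) - Y (s - h) equal to 2 h p. *)
have au2 : a - u2 = - L2_pos (- (u1 - u2)).
  have : (u1 `&` u2)%O = (u2 `&` u1)%O by rewrite meetC.
  rewrite !L2_meet_pos -pE -aE opprB => ->.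
  by rewrite addrAC subrr add0r.
have [X XE] : exists X : R -> H, forall s, X s = a + s *: p by eexists.
have [Y YE] : exists Y : R -> H, forall s, Y s = u2 + s *: p by eexists.
have CX s : 0 <= s <= 1 -> C (X s).
  move=> s01; have := C_segment Cu1 Ca s01.
  by rewrite {1}u1E scalerDr addrAC -scalerDl [s + _]addrC subrK scale1r XE.
have CY s : 0 <= s <= 1 -> C (Y s).
  move=> s01; have := C_segment Cb Cu2 s01.
  by rewrite {1}bE scalerDr addrAC -scalerDl [s + _]addrC subrK scale1r YE.
have XY s h : 0 <= h -> h <= s -> s + h <= 1 ->
    (psi (X s) + psi (Y s) <= psi (X (s + h)%R) + psi (Y (s - h)%R))%E.
  move=> h0 hs sh.
  have CXs : C (X (s + h)) by apply: CX; lra.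
  have CYs : C (Y (s - h)) by apply: CY; lra.
  have := order_preserving_midpoint Sop CXs CYs.
  have posE : L2_pos (X (s + h) - Y (s - h)) = (2 * h) *: p.
    have -> : X (s + h) - Y (s - h) = (2 * h) *: L2_pos (u1 - u2) - L2_pos (- (u1 - u2)).
      rewrite XE YE line_sub (_ : s + h - (s - h) = 2 * h); last by ring.
      by rewrite au2 addrC pE.
    by rewrite pE L2_pos_disjoint// mulr_ge0.
  rewrite posE scalerA mulrA mulVf// mul1r.
  have -> : X (s + h) - h *: p = X s by rewrite !XE scalerDl addrA addrK.
  by have -> : Y (s - h) + h *: p = Y s by rewrite !YE -addrA -scalerDl subrK.
have X1 : X 1 = u1 by rewrite XE scale1r -u1E.
have Y0 : Y 0 = u2 by rewrite YE scale0r addr0.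
have [|D1] := eqVneq (psi u1) +oo%E.
  by move=> ->; rewrite addye ?leey// gt_eqF.
have [|D2] := eqVneq (psi u2) +oo%E.
  by move=> ->; rewrite addey ?leey// gt_eqF.
have {}D1 : edomain psi u1 by rewrite /edomain/= lt_neqAle D1 leey.
have {}D2 : edomain psi u2 by rewrite /edomain/= lt_neqAle D2 leey.
have segment_dom x y (t : R) : edomain psi x -> edomain psi y -> 0 <= t <= 1 ->
    edomain psi (t *: x + (1 - t) *: y).
  move=> Dx Dy /andP[]; rewrite !le_eqVlt => /predU1P[<-|t0] /predU1P[|t1].
  - by move/eqP; rewrite eq_sym oner_eq0.
  - by rewrite scale0r add0r subr0 scale1r.
  - by move=> ->; rewrite scale1r subrr scale0r addr0.
  have [rx psix] := edomain_fin psiNy Dx; have [ry psiy] := edomain_fin psiNy Dy.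
  apply: le_lt_trans (psi_convex x y t _) _; first by rewrite t0.
  by rewrite psix psiy -!EFinM -EFinD ltry.
(* psi has to be finite on the half-open segments before the inequalities can
   be subtracted; midpoints propagate finiteness from u1 and u2. *)
have dyadic (n : nat) : edomain psi (X (2^-1 ^+ n)) /\ edomain psi (Y (1 - 2^-1 ^+ n)).
  elim: n => [|n [IHX IHY]]; first by rewrite !expr0 subrr X1 Y0.
  have hn0 : 0 < (2^-1 : R) ^+ n.+1 by rewrite exprn_gt0.
  have hn1 : (2^-1 : R) ^+ n.+1 <= 2^-1.
    by rewrite exprS ler_piMr// exprn_ile1//; lra.
  have hnn : (2^-1 : R) ^+ n = 2^-1 ^+ n.+1 + 2^-1 ^+ n.+1.
    by rewrite exprS; lra.
  have h1 : (2^-1 : R) ^+ n.+1 + 2^-1 ^+ n.+1 <= 1 by lra.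
  split.
    have := XY _ _ (ltW hn0) (lexx _) h1; rewrite -hnn subrr Y0 => XYn.
    apply: (proj1 (lty_add_inv (psiNy _) (psiNy (Y (2^-1 ^+ n.+1))) _)).
    apply: le_lt_trans XYn _.
    by apply: lte_add_pinfty.
  have := XY (1 - 2^-1 ^+ n.+1) (2^-1 ^+ n.+1) (ltW hn0).
  have -> : 1 - 2^-1 ^+ n.+1 - 2^-1 ^+ n.+1 = 1 - 2^-1 ^+ n :> R by lra.
  rewrite subrK X1 => XYn.
  apply: (proj2 (lty_add_inv (psiNy (X (1 - 2^-1 ^+ n.+1))) (psiNy _) _)).
  apply: le_lt_trans (XYn _ _) _; [lra|lra|].
  by apply: lte_add_pinfty.
have dom (s : R) : 0 < s -> s <= 1 -> edomain psi (X s) /\ edomain psi (Y (1 - s)).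
  move=> s0 s1.
  have [n ns] : exists n : nat, (2^-1 : R) ^+ n <= s.
    have : s^-1 <= 2 ^+ (Num.truncn s^-1).+1.
      apply: le_trans (ltW (truncnS_gt _)) _.
      by rewrite -natrX ler_nat ltnW// ltn_expl.
    set n := (Num.truncn _).+1 => sn; exists n; rewrite exprVn -[leRHS]invrK.
    by rewrite lef_pV2 ?posrE ?exprn_gt0 ?invr_gt0.
  set e : R := 2^-1 ^+ n in ns *; have [DX DY] := dyadic n; rewrite -/e in DX DY.
  have [->|s1'] := eqVneq s 1; first by rewrite subrr X1 Y0.
  have {s1'}s1 : s < 1 by rewrite lt_neqAle s1'.
  have e1 : 0 < 1 - e by rewrite subr_gt0 (le_lt_trans ns).
  pose t := (s - e) / (1 - e).
  have tE : t * (1 - e) = s - e by rewrite divfK// gt_eqF.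
  have t01 : 0 <= t <= 1.
    apply/andP; split; first by apply: divr_ge0; [rewrite subr_ge0|exact: ltW].
    by rewrite ler_pdivrMr// mul1r lerD2r ltW.
  split.
    have -> : X s = t *: X 1 + (1 - t) *: X e.
      by rewrite !XE line_comb (_ : t * 1 + (1 - t) * e = s)//; lra.
    by rewrite X1; exact: segment_dom.
  have -> : Y (1 - s) = t *: Y 0 + (1 - t) *: Y (1 - e).
    by rewrite !YE line_comb (_ : t * 0 + (1 - t) * (1 - e) = 1 - s)//; lra.
  by rewrite Y0; exact: segment_dom.
rewrite leNgt; apply/negP => lt_psi.
have [r1 psi1] := edomain_fin psiNy D1; have [r2 psi2] := edomain_fin psiNy D2.
rewrite psi1 psi2 -EFinD in lt_psi.
have [c1 [c2 [rc ca cb]]] := lte_add_split (psiNy _) (psiNy _) lt_psi.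
have [e1 e10 e1P] := psi_lower_bound_near ca; have [e2 e20 e2P] := psi_lower_bound_near cb.
pose e := Num.min e1 e2; have e0 : 0 < e by rewrite lt_min e10.
pose N := Num.truncn (`|p| / e).
pose h : R := N.+2%:R^-1; have h0 : 0 < h by rewrite invr_gt0.
have he : h * `|p| < e.
  rewrite mulrC ltr_pdivrMr// -ltr_pdivrMl// mulrC.
  by apply: lt_trans (truncnS_gt _) _; rewrite ltr_nat.
have hle1 : h <= 1 by rewrite invf_le1// ler1n.
pose f s := fine (psi (X s)); pose g s := fine (psi (Y s)).
have fg s k : 0 < k -> k <= s -> s + k <= 1 -> f s + g s <= f (s + k) + g (s - k).
  move=> k0 ks sk.
  have [x1 X1E] : exists r : R, psi (X s) = r%:E.
    by apply: edomain_fin => //; apply: (proj1 (dom s _ _)); lra.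
  have [x2 X2E] : exists r : R, psi (X (s + k)) = r%:E.
    by apply: edomain_fin => //; apply: (proj1 (dom _ _ _)); lra.
  have [y1 Y1E] : exists r : R, psi (Y s) = r%:E.
    apply: edomain_fin => //; rewrite -[s](subKr 1); apply: (proj2 (dom _ _ _)); lra.
  have [y2 Y2E] : exists r : R, psi (Y (s - k)) = r%:E.
    apply: edomain_fin => //; rewrite -[s - k](subKr 1); apply: (proj2 (dom _ _ _)); lra.
  have := XY s k (ltW k0) ks sk.
  by rewrite /f /g X1E X2E Y1E Y2E -!EFinD lee_fin.
have := telescope_rearranged N fg; rewrite -/h /f /g X1 Y0 psi1 psi2 /=.
have [DXh DYh] := dom h h0 hle1.
have [x XhE] := edomain_fin psiNy DXh; have [y YhE] := edomain_fin psiNy DYh.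
have cx : c1 < x.
  rewrite -lte_fin -XhE; apply: e1P.
  rewrite XE addrAC subrr add0r normrZ gtr0_norm//.
  by apply: lt_le_trans he _; rewrite ge_min lexx.
have cy : c2 < y.
  rewrite -lte_fin -YhE; apply: e2P.
  rewrite YE bE opprD addrACA subrr add0r scalerBl scale1r addrAC subrr add0r.
  rewrite normrN normrZ gtr0_norm//.
  by apply: lt_le_trans he _; rewrite ge_min lexx orbT.
by rewrite XhE YhE /=; lra.
Qed.

End order.

(** * The equivalence *)

Unset Implicit Arguments.

Theorem corollary3p6 (d : measure_display) (Sigma : measurableType d)
    (R : realType) (mu : {measure set Sigma -> \bar R})
    (V : tvsType R) (j : {linear V -> LspaceType2 mu})
    (j_weak : continuous (j : weak V -> weak (LspaceType2 mu)))
    (phi : V -> \bar R) (phi_gtNy : forall v, (-oo < phi v)%E)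
    (phi_convex : econvex phi) (phi_proper : edomain phi !=set0)
    (phi_lsc : lower_semicontinuous phi) (phi_elliptic : j_elliptic phi j)
    (j_dense : dense (j @` edomain phi))
    (phiH : LspaceType2 mu -> \bar R) (phiHP : H_functional phi j phiH)
    (C : set (LspaceType2 mu)) (C_closed : closed C) (C_convex : convex_set C)
    (C_meet : forall u v, C u -> C v -> C (u `&` v)%O)
    (C_join : forall u v, C u -> C v -> C (u `|` v)%O)
    (S : R -> LspaceType2 mu -> LspaceType2 mu)
    (S_gen : generated_semigroup phi j S) (S_inv : leaves_invariant S C) :
  let assertion1 := order_preserving_on S C in
  let assertion2 := forall u1 u2, C u1 -> C u2 ->
    (phiH (u1 `&` u2)%O + phiH (u1 `|` u2)%O <= phiH u1 + phiH u2)%E in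
  let assertion3 := forall u1' u2', edomain phi u1' -> edomain phi u2' ->
    C (j u1') -> C (j u2') ->
    exists v1' v2', [/\ edomain phi v1', edomain phi v2',
      (j u1' `&` j u2')%O = j v1', (j u1' `|` j u2')%O = j v2' &
      (phi v1' + phi v2' <= phi u1' + phi u2')%E] in
  (assertion1 <-> assertion2) /\ (assertion2 <-> assertion3).
Proof.
move=> assertion1 assertion2 assertion3.
have [omega omega0 [_ coer]] := phi_elliptic.
have [c [le_phi attained]] := H_functional_infimum j_weak phi_gtNy phi_convex
  phi_proper phi_lsc omega0 coer phiHP.
have [phiHNy _ _ _ _] := phiHP.
split; split.
- by move=> Sop; apply: (order_preserving_submodular j_dense phiHP C_convex
    C_meet C_join S_gen).
- by move=> sm; apply: (submodular_order_preserving j_dense phiHP S_gen S_inv).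
- move=> sm u1' u2' D1 D2 C1 C2.
  have [r1 phi1] := edomain_fin phi_gtNy D1.
  have [r2 phi2] := edomain_fin phi_gtNy D2.
  have h1 := le_phi _ D1; have h2 := le_phi _ D2.
  rewrite phi1 -EFinD in h1; rewrite phi2 -EFinD in h2.
  have h12 := le_trans (sm _ _ C1 C2) (leeD h1 h2).
  rewrite -EFinD in h12.
  have [Dm Dj] := lty_add_inv (phiHNy _) (phiHNy _) (le_lt_trans h12 (ltry _)).
  have [v1' [Dv1 jv1 phiv1]] := attained _ Dm.
  have [v2' [Dv2 jv2 phiv2]] := attained _ Dj.
  exists v1', v2'; split=> //.
  have [s1 phis1] := edomain_fin phi_gtNy Dv1.
  have [s2 phis2] := edomain_fin phi_gtNy Dv2.
  move: (le_trans (leeD phiv1 phiv2) h12).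
  by rewrite phi1 phi2 phis1 phis2 -!EFinD !lee_fin; lra.
- move=> sub u1 u2 C1 C2.
  have [->|/eqP D1] := eqVneq (phiH u1) +oo%E.
    by rewrite addye ?leey// gt_eqF.
  have [->|/eqP D2] := eqVneq (phiH u2) +oo%E.
    by rewrite addey ?leey// gt_eqF.
  have {}D1 : edomain phiH u1 by rewrite /edomain/= ltey; exact/eqP.
  have {}D2 : edomain phiH u2 by rewrite /edomain/= ltey; exact/eqP.
  have [u1' [D1' ju1 le1]] := attained _ D1.
  have [u2' [D2' ju2 le2]] := attained _ D2.
  have C1' : C (j u1') by rewrite ju1.
  have C2' : C (j u2') by rewrite ju2.
  have [v1' [v2' [Dv1 Dv2 jv1 jv2 le12]]] := sub u1' u2' D1' D2' C1' C2'.
  rewrite -ju1 -ju2 jv1 jv2.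
  have [r1 phi1] := edomain_fin phi_gtNy D1'.
  have [r2 phi2] := edomain_fin phi_gtNy D2'.
  have [s1 phis1] := edomain_fin phi_gtNy Dv1.
  have [s2 phis2] := edomain_fin phi_gtNy Dv2.
  apply: le_trans (leeD (le_phi _ Dv1) (le_phi _ Dv2)) _.
  rewrite !ju1 !ju2; apply: le_trans (leeD le1 le2).
  move: le12; rewrite phi1 phi2 phis1 phis2 -!EFinD !lee_fin; lra.
Qed.
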